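(* Let $k\in\mathbb{N}$. If $\boldsymbol{a}\in A^{(k)}$ and $\boldsymbol{b}\in\mathbb{R}^k$ are $\mathbb{Z}$-independent, then the set $$\mathfrak{E}^{(k)}_{\boldsymbol{a},\boldsymbol{b}}=\{\lambda\in(0,1): f_{\boldsymbol{a},\boldsymbol{b},\lambda}\text{ is not asymptotically periodic}\}$$ has zero Hausdorff dimension, i.e. $\dim_H\mathfrak{E}^{(k)}_{\boldsymbol{a},\boldsymbol{b}}=0$.
   Context: $\mathbb{N}=\{1,2,\ldots\}$ and $I=[0,1)$. For $k\in\mathbb{N}$, $A^{(k)}=\{(0,a_1,\ldots,a_{k-1})\in\mathbb{R}^k: 0<a_1<\cdots<a_{k-1}<1\}$. Given $\boldsymbol{a}=(0,a_1,\ldots,a_{k-1})\in A^{(k)}$, $\boldsymbol{b}=(b_1,\ldots,b_k)\in\mathbb{R}^k$ and $0<\lambda<1$, put $a_0=0$, $a_k=1$, let $F:I\to\mathbb{R}$ be given by $F(x)=\lambda x+b_i$ for $x\in[a_{i-1},a_i)$, $1\le i\le k$, and let $f_{\boldsymbol{a},\boldsymbol{b},\lambda}:I\to I$ be $f_{\boldsymbol{a},\boldsymbol{b},\lambda}(x)=F(x)\pmod 1$ (representative in $[0,1)$). Two tuples $\boldsymbol{x}=(x_1,\ldots,x_k)\in\mathbb{R}^k$ and $\boldsymbol{y}=(y_1,\ldots,y_k)\in\mathbb{R}^k$ are $\mathbb{Z}$-independent if $x_i-y_j\notin\mathbb{Z}$ for all $(i,j)\in\{1,\ldots,k\}^2$.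 (So for $\boldsymbol{a}=(a_0,a_1,\ldots,a_{k-1})\in A^{(k)}$ with $a_0=0$, and $\boldsymbol{b}=(b_1,\ldots,b_k)\in\mathbb{R}^k$, this means $a_i-b_j\notin\mathbb{Z}$ for $0\le i\le k-1$, $1\le j\le k$.) For $f:I\to I$ and $x\in I$, $\omega(f,x)$ is the $\omega$-limit set of $f$ at $x$, and $\omega(f)=\bigcup_{x\in I}\omega(f,x)$. The map $f$ is asymptotically periodic if for every $x\in I$ the set $\omega(f,x)$ equals a periodic orbit of $f$, and $\omega(f)$ consists of finitely many periodic orbits. *)

(* Defs.v *)
From mathcomp Require Import all_boot all_order all_algebra.
From mathcomp Require Import all_classical all_reals all_analysis.
Set Implicit Arguments.
Unset Strict Implicit.
Unset Printing Implicit Defensive.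
Import Order.TTheory GRing.Theory Num.Theory numFieldNormedType.Exports.
Local Open Scope classical_set_scope.
Local Open Scope ring_scope.

Section PiecewiseAffine.
Context {R : realType} {k : nat}.

Definition unit_interval : set R := `[0, 1[.

(* The coordinates a_0, ..., a_{k-1} of a point of R^k are the entries of a row
   vector; the point a_0 = 0 is its first entry, hence needs 0 < k. *)
Definition partition_points : set 'rV[R]_k :=
  [set a | [/\ forall i : 'I_k, i = 0%N :> nat -> a ord0 i = 0,
               forall i j : 'I_k, (i < j)%N -> a ord0 i < a ord0 j
             & forall i : 'I_k, a ord0 i < 1]].

(* a_i for 0 <= i <= k, where a_k = 1. *)
Definition breakpoint (a : 'rV[R]_k) (i : nat) : R :=
  if insub i is Some j then a ord0 j else 1.

(* Branches are numbered from 0: the branch on [a_i, a_{i+1}) has constant term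
   b ord0 i.  The branches cover [0, 1); values outside [0, 1) are junk. *)
Definition affine_lift (a b : 'rV[R]_k) (lambda x : R) : R :=
  if [pick i : 'I_k | breakpoint a i <= x < breakpoint a i.+1] is Some i
  then lambda * x + b ord0 i else 0.

Definition mod1 (x : R) : R := x - (Num.floor x)%:~R.

Definition pw_map (a b : 'rV[R]_k) (lambda x : R) : R :=
  mod1 (affine_lift a b lambda x).

Definition Z_independent (x y : 'rV[R]_k) : Prop :=
  forall i j : 'I_k, x ord0 i - y ord0 j \isn't a Num.int.

End PiecewiseAffine.

(* A self-map of X is represented by f : T -> T mapping X into X. *)
Section Dynamics.
Context {T : topologicalType}.
Implicit Types (X P : set T) (f : T -> T) (x : T).

(* Accumulation points of the forward orbit, in the subspace topology of X. *)
Definition omega_limit X f x : set T :=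
  X `&` cluster ((fun n : nat => iter n f x) @ \oo).

Definition omega_limit_all X f : set T := \bigcup_(x in X) omega_limit X f x.

Definition periodic_orbit X f P : Prop :=
  exists p : T, exists n : nat,
    [/\ X p, (0 < n)%N, iter n f p = p & P = range (fun m : nat => iter m f p)].

Definition asymptotically_periodic X f : Prop :=
  (forall x, X x -> periodic_orbit X f (omega_limit X f x)) /\
  exists C : set (set T),
    [/\ finite_set C, forall P, C P -> periodic_orbit X f P
      & omega_limit_all X f = \bigcup_(P in C) P].

End Dynamics.

Section HausdorffDimension.
Context {R : realType}.
Local Open Scope ereal_scope.
Implicit Types (A E : set R) (s delta : R).

Definition diam A : \bar R :=
  ereal_sup (0 |` [set `|z.1 - z.2|%:E | z in A `*` A]).

(* The power 0 `^ 0 is 1, so that for s = 0 each nonempty set contributes 1. *)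
Definition diam_pow s A : \bar R := if A == set0 then 0 else diam A `^ s.

Definition hausdorff_premeasure s delta E : \bar R :=
  ereal_inf [set \sum_(0 <= n <oo) diam_pow s (U n) | U in
    [set U : (set R)^nat |
       E `<=` \bigcup_n U n /\ forall n, diam (U n) <= delta%:E]].

Definition hausdorff_measure s E : \bar R :=
  ereal_sup [set hausdorff_premeasure s delta E | delta in [set d | (0 < d)%R]].

Definition hausdorff_dim E : \bar R :=
  ereal_inf [set s%:E | s in [set s | (0 <= s)%R /\ hausdorff_measure s E = 0]].

End HausdorffDimension.

Definition exceptional_set {R : realType} {k : nat} (a b : 'rV[R]_k) : set R :=
  [set lambda | 0 < lambda < 1 /\
     ~ asymptotically_periodic unit_interval (pw_map a b lambda)].

(* Main.v *)
(** Fix lambda.  If some iterate of the interval stays away from all breakpoints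
    a_0 = 0, ..., a_k = 1, nearby points of its closure follow the same branch and
    contract, so the map is asymptotically periodic.  Hence for an exceptional
    lambda and every n some orbit x_0, ..., x_n comes within lambda^n of a
    breakpoint a_i; writing x_n as an affine function of x_0, this says
    |P_w(lambda) - a_i| <= 2 lambda^n for a polynomial P_w whose coefficients are
    the translation parts of the branches visited.

    Two facts bound the number of t-separated exceptional lambda <= rho < 1.
    - P_w - a_i has bounded coefficients and, by Z-independence, a constant term
      bounded away from 0.  Dividing out near-zeros by Blaschke factors (a form of
      Jensen's inequality) shows that it is tiny at no more than d points that are
      t-separated, where d depends only on rho and t is about rho^(n/d).
    - Outside countably many lambda (roots of polynomials which are nonzero, again
      by Z-independence) breakpoints do not return to breakpoints in fewer than p
      steps.  So codes of orbits of nearby parameters branch at most once in p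
      steps, and there are at most C (2k)^(n/p) words w of length n.
    Taking p large makes the s-dimensional sums vanish, for every s > 0. *)
Require Import Defs.
From mathcomp Require Import all_boot all_order all_algebra.
From mathcomp Require Import all_classical all_reals all_analysis.
From mathcomp Require Import zify ring lra.
Set Implicit Arguments.
Unset Strict Implicit.
Unset Printing Implicit Defensive.
Import Order.TTheory GRing.Theory Num.Theory numFieldNormedType.Exports.

(** * Counting sparsely branching codes *)

Lemma size_le_fibers (T1 T2 : eqType) (h : T1 -> T2) (l : seq T1) (K : nat) :
  (forall y, count (fun x => h x == y) l <= K) ->
  size l <= size (undup (map h l)) * K.
Proof.
move=> hK; have -> : size l = count (fun x => h x \in undup (map h l)) l.
  rewrite -(count_predT l); apply/eq_in_count => x xl /=.
  by rewrite mem_undup map_f.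
elim: (undup _) => [|y U IH] /=; first by rewrite (eq_count (a2 := pred0)) ?count_pred0.
rewrite mulSn; apply: leq_trans (leq_add (hK y) IH).
rewrite -count_predUI -[leqLHS]addn0 leq_add // sub_count //.
Qed.

Lemma mkseq_eqP (A : Type) (g h : nat -> A) n :
  mkseq g n = mkseq h n <-> (forall i, i < n -> g i = h i).
Proof.
split=> [gh i ni|gh]; last by apply/eq_in_map => i; rewrite mem_iota => /gh.
by rewrite -(nth_mkseq (g i) g ni) gh nth_mkseq.
Qed.

Lemma take_mkseq (A : Type) (g : nat -> A) m n : take m (mkseq g (m + n)) = mkseq g m.
Proof. by rewrite /mkseq -map_take take_iota (minn_idPl (leq_addr _ _)). Qed.

Section SparseBranching.
Variables (A : finType) (T : Type) (code : T -> nat -> A) (P : T -> Prop).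
Variables (n0 p : nat).
(** Read along [w1]: once it has split from some [w2] at time j, it splits from no [w3] during the
    next p - 1 steps. Two companions are needed, since the two splittings may involve different
    orbits. *)
Hypothesis sparse : forall w1 w2 w3 j m, P w1 -> P w2 -> P w3 ->
  n0 <= j -> 0 < m < p ->
  (forall i, i < j -> code w1 i = code w2 i) -> code w1 j <> code w2 j ->
  (forall i, i < j + m -> code w1 i = code w3 i) ->
  code w1 (j + m) <> code w3 (j + m) -> False.

Let prefixes n (U : seq (seq A)) :=
  uniq U /\ forall u, u \in U -> exists2 w, P w & u = mkseq (code w) n.

Let split_at w w' j :=
  (forall i, i < j -> code w i = code w' i) /\ code w j <> code w' j.

Let split_sym w w' j : split_at w w' j -> split_at w' w j.
Proof. by move=> [ww ne]; split=> [i /ww //|/esym]. Qed.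

(** Two distinct times in a window of length p differ by less than p, so the earlier one and the
    difference contradict [sparse]. *)
Let split_unique n w1 w2 w3 j j' : n0 <= n -> P w1 -> P w2 -> P w3 ->
  n <= j < n + p -> n <= j' < n + p -> split_at w1 w2 j -> split_at w1 w3 j' ->
  j = j'.
Proof.
move=> nn P1 P2 P3 /andP[nj jp] /andP[nj' jp'] s2 s3.
have [lt|lt|//] := ltngtP j j'; exfalso.
  apply: (sparse P1 P2 P3 (j := j) (m := j' - j)); rewrite ?subnKC ?(ltnW lt) //; try lia.
  - exact: s2.1. - exact: s2.2. - exact: s3.1. - exact: s3.2.
apply: (sparse P1 P3 P2 (j := j') (m := j - j')); rewrite ?subnKC ?(ltnW lt) //; try lia.
- exact: s3.1. - exact: s3.2. - exact: s2.1. - exact: s2.2.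
Qed.

Let exists_split n w w' : mkseq (code w) n = mkseq (code w') n ->
  mkseq (code w) (n + p) <> mkseq (code w') (n + p) ->
  exists2 j, n <= j < n + p & split_at w w' j.
Proof.
move=> /mkseq_eqP ww ne.
have exj : exists j, (j < n + p) && (code w j != code w' j).
  apply: contrapT => nex; apply: ne; apply/mkseq_eqP => i ip.
  by apply/eqP; apply/negPn/negP => wi; apply: nex; exists i; rewrite ip.
case: (ex_minnP exj) => j /andP[jp /eqP wj] jmin; exists j; last first.
  split=> // i ij; apply/eqP/negPn/negP => wi.
  by have := jmin i; rewrite wi (ltn_trans ij jp) leqNgt ij => /(_ isT).
rewrite jp andbT leqNgt; apply/negP => jn.
by apply: wj; exact: ww.
Qed.

(** All extensions of one prefix split pairwise at the same time j of the window, so the letter at j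
    determines the extension and each prefix has at most [#|A|] of them. *)
Let prefixes_step n M : n0 <= n ->
  (forall U, prefixes n U -> size U <= M) ->
  forall U, prefixes (n + p) U -> size U <= M * #|A|.
Proof.
move=> nn HM U [Uu UP].
have /leq_trans-> // : size U <= size (undup (map (take n) U)) * #|A|.
  apply: size_le_fibers => v; rewrite -size_filter.
  set F := [seq u <- U | take n u == v].
  have Fu : uniq F by exact: filter_uniq.
  have FU u : u \in F -> u \in U by rewrite mem_filter => /andP[].
  have Fv u : u \in F -> take n u = v by rewrite mem_filter => /andP[/eqP].
  have [->//|[u0 u0F]] : F = [::] \/ exists u, u \in F.
    by case: F {Fu FU Fv} => [|u F]; [left|right; exists u; rewrite mem_head].
  have [w0 Pw0 _] := UP _ (FU _ u0F).
  have /choice[W HW] : forall u, exists w, u \in F -> P w /\ u = mkseq (code w) (n + p).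
    move=> u; have [uF|] := boolP (u \in F); last by exists w0.
    by have [w Pw uw] := UP _ (FU _ uF); exists w.
  have splitF u u' : u \in F -> u' \in F -> u <> u' ->
      exists2 j, n <= j < n + p & split_at (W u) (W u') j.
    move=> uF u'F uu'; apply: exists_split.
      by rewrite -!(take_mkseq _ n p) -(HW u uF).2 -(HW u' u'F).2 !Fv.
    by rewrite -(HW u uF).2 -(HW u' u'F).2.
  have [Fsub|[u1 [u1F u01]]] : {subset F <= [:: u0]} \/ exists u1, u1 \in F /\ u0 <> u1.
    have [|nex] := pselect (exists u1, u1 \in F /\ u0 <> u1); [by right|left].
    move=> u uF; rewrite inE; apply/eqP; apply: contrapT => uu0; apply: nex.
    by exists u; split=> // /esym.
    apply: leq_trans (uniq_leq_size Fu Fsub) _.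
    by apply/card_gt0P; exists (code w0 0).
  have [j jn s01] := splitF _ _ u0F u1F u01.
  (* [split_unique] compares only splittings that share a word, so an arbitrary pair is linked to
     [u0], [u1] through the splitting of [u0] from [u]. *)
  have same u u' j' : u \in F -> u' \in F -> n <= j' < n + p ->
      split_at (W u) (W u') j' -> j = j'.
    move=> uF u'F j'n s; have [u0u|u0u] := eqVneq u0 u.
      rewrite -u0u in s; apply: (split_unique nn _ _ _ jn j'n s01 s).
      - exact: (HW _ u0F).1. - exact: (HW _ u1F).1. - exact: (HW _ u'F).1.
    have [j2 j2n s2] := splitF _ _ u0F uF (elimN eqP u0u).
    have -> : j = j2.
      apply: (split_unique nn _ _ _ jn j2n s01 s2).
      - exact: (HW _ u0F).1. - exact: (HW _ u1F).1. - exact: (HW _ uF).1.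
    apply: (split_unique nn _ _ _ j2n j'n (split_sym s2) s).
    - exact: (HW _ uF).1. - exact: (HW _ u0F).1. - exact: (HW _ u'F).1.
  have inj : {in F &, injective (fun u => code (W u) j)}.
    move=> u u' uF u'F /= cj; apply: contrapT => uu'.
    have [j' j'n s] := splitF _ _ uF u'F uu'.
    by apply: s.2; rewrite -(same _ _ _ uF u'F j'n s).
  rewrite -(size_map (fun u => code (W u) j)) cardE.
  by apply: uniq_leq_size; [rewrite map_inj_in_uniq|move=> x _; rewrite mem_enum].
rewrite leq_mul2r HM ?orbT //; split; first exact: undup_uniq.
move=> v; rewrite mem_undup => /mapP[u /UP[w Pw ->] ->]; exists w => //.
by rewrite take_mkseq.
Qed.

(** The first [n0] letters are unrestricted; afterwards each block of p letters costs a single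
    factor [#|A|]. *)
Lemma size_prefixes_le l (U : seq (seq A)) : uniq U ->
  (forall u, u \in U -> exists2 w, P w & u = mkseq (code w) (n0 + l * p)) ->
  size U <= #|A| ^ (n0 + l).
Proof.
move=> uU UP; have {uU UP} : prefixes (n0 + l * p) U by [].
elim: l U => [|l IH] U.
  rewrite mul0n !addn0 => -[uU UP]; rewrite -card_tuple cardE.
  rewrite -(size_map (@tval n0 A)); apply: uniq_leq_size => // u /UP[w _ uw].
  have su : size u == n0 by rewrite uw size_mkseq.
  by apply/mapP; exists (Tuple su) => //; rewrite mem_enum.
rewrite mulSn addnCA addnC addnS expnSr => /prefixes_step; apply=> //.
exact: leq_addr.
Qed.

End SparseBranching.

Local Open Scope classical_set_scope.
Local Open Scope ring_scope.

(** * Small values of polynomials *)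

Definition spaced {R : realFieldType} (t : R) (l : seq R) :=
  pairwise (fun x y => t <= `|x - y|) l.

Section PolySmallValues.
Context {R : realFieldType}.
Implicit Types (p q : {poly R}) (x t e A r : R).

(** By Parseval, the mean of |p|^2 over the unit circle; the coefficient form keeps the Jensen-type
    argument free of integrals. *)
Definition sqnorm p := \sum_(i < size p) p`_i ^+ 2.

Lemma sqnorm_widen p n : (size p <= n)%N -> sqnorm p = \sum_(i < n) p`_i ^+ 2.
Proof.
move=> pn; rewrite /sqnorm -!(big_mkord xpredT (fun i => p`_i ^+ 2)).
rewrite (big_cat_nat (n := size p) (p := n)) //=.
rewrite [X in _ + X]big_nat_cond [X in _ + X]big1 ?addr0 // => i.
by rewrite andbT => /andP[pi _]; rewrite nth_default // expr0n.
Qed.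

Lemma sqnorm_ge_coef0 p : p`_0 ^+ 2 <= sqnorm p.
Proof.
rewrite (sqnorm_widen (leqnSn _)) big_ord_recl /= lerDl.
by apply: sumr_ge0 => i _; exact: sqr_ge0.
Qed.

(* |1 - x z| = |z - x| on the unit circle, i.e. the Blaschke factor
   (z - x) / (1 - x z) is unimodular there. *)
Lemma sqnorm_blaschke q x :
  sqnorm (q * (1 - x *: 'X)) = sqnorm (q * ('X - x%:P)).
Proof.
pose u i : R := if i is j.+1 then q`_j else 0.
have c1 i : (q * (1 - x *: 'X))`_i = q`_i - x * u i.
  by rewrite mulrBr mulr1 coefB -scalerAr coefZ coefMX; case: i.
have c2 i : (q * ('X - x%:P))`_i = u i - x * q`_i.
  by rewrite mulrBr coefB coefMX mulrC mul_polyC coefZ; case: i.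
have s1 : (size (q * (1 - x *: 'X))%R <= (size q).+1)%N.
  by apply/leq_sizeP => -[|j] // qj; rewrite c1 /= !nth_default ?mulr0 ?subr0 // ltnW.
have s2 : (size (q * ('X - x%:P))%R <= (size q).+1)%N.
  by apply/leq_sizeP => -[|j] // qj; rewrite c2 /= !nth_default ?mulr0 ?subr0 // ltnW.
rewrite (sqnorm_widen s1) (sqnorm_widen s2); apply/eqP; rewrite -subr_eq0 -sumrB.
(* The differences of squared coefficients telescope, and the remainder vanishes at n = [size q]. *)
suff H n : \sum_(i < n.+1) ((q * (1 - x *: 'X))`_i ^+ 2 -
    (q * ('X - x%:P))`_i ^+ 2) = (1 - x ^+ 2) * q`_n ^+ 2.
  by rewrite H nth_default // expr0n mulr0.
elim: n => [|n IH]; first by rewrite big_ord_recl big_ord0 c1 c2 /=; ring.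
by rewrite big_ord_recr /= IH c1 c2 /=; ring.
Qed.

(** Only the constant coefficient changes, and it is at most A in absolute value. *)
Lemma sqnorm_subC p x A : 0 <= A -> sqnorm p <= A ^+ 2 ->
  sqnorm (p - x%:P) <= (A + `|x|) ^+ 2.
Proof.
move=> A0 pA.
have s1 : (size (p - x%:P)%R <= (size p).+1)%N.
  apply: (leq_trans (size_polyD _ _)); rewrite size_polyN geq_max leqnSn /=.
  by apply: (leq_trans (size_polyC_leq1 _)).
have -> : sqnorm (p - x%:P) = sqnorm p - 2 * x * p`_0 + x ^+ 2.
  rewrite (sqnorm_widen s1) (sqnorm_widen (leqnSn _)) !big_ord_recl /=.
  rewrite coefB coefC /= (eq_bigr (fun i : 'I_(size p) => p`_i.+1 ^+ 2)); first by ring.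
  by move=> i _; rewrite coefB coefC /= subr0.
have p0A : `|p`_0| <= A.
  rewrite -(ler_pXn2r (n := 2)) ?nnegrE // real_normK ?num_real //.
  exact: le_trans (sqnorm_ge_coef0 p) pA.
have : - (2 * x * p`_0) <= 2 * A * `|x|.
  rewrite (le_trans (ler_norm _)) // normrN !normrM (ger0_norm (ler0n _ 2)).
  by rewrite -!mulrA ler_wpM2l // mulrC ler_wpM2r.
have : x ^+ 2 = `|x| ^+ 2 by rewrite real_normK ?num_real.
move: (`|x|) => y ->; nra.
Qed.

(* A small value p(x) can be divided out: (p - p(x)) (1 - x X) / (X - x) has the
   same norm as p - p(x), and a constant term larger by the factor 1 / x. *)
Lemma coef0_le_small_values r t e (l : seq R) p A :
    0 <= r <= 1 -> 0 < t <= 1 -> 0 <= e -> 0 <= A -> sqnorm p <= A ^+ 2 ->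
    spaced t l -> (forall x, x \in l -> 0 <= x <= r /\ `|p.[x]| <= e) ->
  `|p`_0| <= r ^+ size l * A + (4 / t) ^+ size l * e.
Proof.
move=> /andP[r0 r1] /andP[t0 t1].
elim: l p e A => [|x l IH] p e A e0 A0 pA /=.
  move=> _ _; rewrite !expr0 !mul1r (@le_trans _ _ A) ?lerDl //.
  rewrite -(ler_pXn2r (n := 2)) ?nnegrE // real_normK ?num_real //.
  exact: le_trans (sqnorm_ge_coef0 p) pA.
move=> /andP[/allP xl sl] H.
have [/andP[x0 xr] px] := H x (mem_head _ _).
have : root (p - p.[x]%:P) x by rewrite rootE hornerD hornerN hornerC subrr.
move=> /factor_theorem[q pq].
pose p1 := q * (1 - x *: 'X).
have p1A : sqnorm p1 <= (A + e) ^+ 2.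
  rewrite /p1 sqnorm_blaschke -pq (le_trans (sqnorm_subC _ A0 pA)) //.
  by rewrite ler_pXn2r ?nnegrE ?addr_ge0 // lerD2l.
(* Since q(y) (y - x) = p(y) - p(x), the spacing costs a factor 1 / t; the new factor 1 - x y lies
   in [0, 1]. *)
have p1l y : y \in l -> 0 <= y <= r /\ `|p1.[y]| <= 2 / t * e.
  move=> yl; have [/andP[y0 yr] py] := H y (mem_behead (s := x :: l) yl).
  split; first by rewrite y0.
  have xy := xl _ yl.
  have xy0 : 0 < `|x - y| by apply: lt_le_trans xy.
  have E : `|q.[y]| * `|x - y| <= 2 * e.
    rewrite -normrM -(normrN (_ * _)) -mulrN opprB.
    have -> : q.[y] * (y - x) = p.[y] - p.[x].
      by have := congr1 (fun u => u.[y]) pq; rewrite !hornerE => <-.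
    by rewrite (le_trans (ler_normB _ _)) // mulr_natl mulr2n lerD.
  have qy : `|q.[y]| <= 2 / t * e.
    rewrite mulrAC ler_pdivlMr //; apply: le_trans E.
    by rewrite ler_wpM2l.
  rewrite /p1 !hornerE /= normrM; apply: le_trans qy.
  rewrite ler_piMr // ger0_norm; nra.
have t2 : 0 <= 2 / t * e by rewrite mulr_ge0 // divr_ge0 // ltW.
have := IH p1 _ _ t2 (addr_ge0 A0 e0) p1A sl p1l.
have -> : p1`_0 = q`_0.
  by rewrite /p1 mulrBr mulr1 coefB -scalerAr coefZ coefMX /= mulr0 subr0.
have p0 : p`_0 = p.[x] - x * q`_0.
  have := congr1 (fun u : {poly R} => u`_0) pq.
  rewrite coefB coefC /= mulrBr coefB coefMX /= mulrC mul_polyC coefZ => E.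
  by rewrite -(subrK p.[x] p`_0) E; ring.
set n := size l; set T := (4 / t) ^+ n => Hq.
have x1 : x <= 1 by apply: le_trans r1.
rewrite p0 (le_trans (ler_normB _ _)) // normrM (ger0_norm x0).
rewrite exprS [(4 / t) ^+ _]exprS -/T.
have T1 : 1 <= T by apply: exprn_ege1; rewrite ler_pdivlMr //; lra.
have rn0 : 0 <= r ^+ n by rewrite exprn_ge0.
have rn1 : r ^+ n <= 1 by rewrite exprn_ile1.
have h1 : x * `|q`_0| <= r * (r ^+ n * A) + 1 * (1 * e) + 1 * (T * (2 / t * e)).
  apply: (le_trans (ler_wpM2l x0 Hq)).
  rewrite mulrDr [r ^+ n * (A + e)]mulrDr mulrDr lerD ?lerD //.
  - by rewrite ler_wpM2r // mulr_ge0.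
  - by rewrite ler_pM // ?mulr_ge0 // ler_wpM2r.
  - by rewrite ler_wpM2r // mulr_ge0 // ltW // (lt_le_trans ltr01 T1).
apply: (le_trans (lerD px h1)).
have ti : 1 <= t^-1 by rewrite invf_ge1.
(* The claim has 4 / t where the induction produces 2 / t; the spare half absorbs two errors e, one
   from |p(x)| and one from the norm bound A + e. *)
suff : 2 * e <= T * (2 * t^-1 * e).
  move: (t^-1) ti T1 => ti; lra.
have : 1 <= T * t^-1 by rewrite mulr_ege1.
move: (t^-1) => ti'; nra.
Qed.

End PolySmallValues.

(** * Hausdorff-null sets *)

Section HausdorffNull.
Context {R : realType}.
Implicit Types (s e t : R) (A E : set R).

(** No bound on the diameters is imposed: for s > 0 a small sum already forces each of them to be
    small. *)
Definition hausdorff_null s E : Prop :=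
  forall e, 0 < e -> exists U : (set R)^nat,
    E `<=` \bigcup_n U n /\ (\sum_(0 <= n <oo) diam_pow s (U n) <= e%:E)%E.

Lemma diam_ge0 A : (0 <= diam A)%E.
Proof. by apply: ereal_sup_ubound; left. Qed.

Lemma diam_set0 : diam (@set0 R) = 0%E.
Proof.
apply/eqP; rewrite eq_le diam_ge0 andbT.
by apply: ge_ereal_sup => x [->//|[z [[]]]].
Qed.

Lemma diam_pow_ge0 s A : (0 <= diam_pow s A)%E.
Proof. by rewrite /diam_pow; case: ifP => // _; exact: poweR_ge0. Qed.

Lemma diam_pow_le s A t : 0 <= s -> 0 <= t ->
  (forall x y, A x -> A y -> `|x - y| <= t) -> (diam_pow s A <= (t `^ s)%:E)%E.
Proof.
move=> s0 t0 At; rewrite /diam_pow; case: ifP => [_|_].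
  by rewrite lee_fin powR_ge0.
rewrite -poweR_EFin; apply: gt0_ler_poweR => //.
- by rewrite in_itv /= diam_ge0 leey.
- by rewrite in_itv /= lee_fin t0 leey.
- apply: ge_ereal_sup => x [->|[z [Az1 Az2] <-]]; rewrite lee_fin //.
  exact: At.
Qed.

Lemma hausdorff_null_measure s E : 0 < s -> hausdorff_null s E ->
  hausdorff_measure s E = 0%E.
Proof.
move=> s0 nE; rewrite /hausdorff_measure.
suff H d : 0 < d -> hausdorff_premeasure s d E = 0%E.
  apply/eqP; rewrite eq_le; apply/andP; split.
    by apply: ge_ereal_sup => x [d d0 <-]; rewrite H.
  by apply: ereal_sup_ubound; exists 1 => //=; rewrite ?H.
move=> d0; rewrite /hausdorff_premeasure; apply/eqP; rewrite eq_le; apply/andP; split.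
  apply/lee_addgt0Pr => e e0; rewrite add0e.
  (* A sum at most d^s makes every single term at most d^s, hence every diameter at most d. *)
  have me : 0 < Num.min e (d `^ s) by rewrite lt_min e0 powR_gt0.
  have [U [EU sU]] := nE _ me.
  apply: (@le_trans _ _ (\sum_(0 <= n <oo) diam_pow s (U n))%E).
    apply: ereal_inf_lbound; exists U => //=; split=> // n.
    have : (diam_pow s (U n) <= (d `^ s)%:E)%E.
      apply: (@le_trans _ _ (\sum_(0 <= n <oo) diam_pow s (U n))%E).
        have := @nneseries_lim_ge R (fun n => diam_pow s (U n)) xpredT 0 n.+1.
        move=> /(_ (fun i _ _ => diam_pow_ge0 _ _)); apply: le_trans.
        rewrite big_nat_recr //= leeDr //.
        by apply: sume_ge0 => i _; exact: diam_pow_ge0.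
      by apply: (le_trans sU); rewrite lee_fin ge_min lexx orbT.
    rewrite /diam_pow; case: eqP => [->|_]; first by move=> _; rewrite diam_set0 lee_fin ltW.
    have := diam_ge0 (U n); case: (diam (U n)) => [r| |] //.
      rewrite poweR_EFin !lee_fin => r0; rewrite !leNgt; apply: contra => dr.
      by apply: gt0_ltr_powR => //; rewrite nnegrE // ltW.
    by rewrite poweRyr ?gt_eqF.
  by apply: (le_trans sU); rewrite lee_fin ge_min lexx.
apply: le_ereal_inf_tmp => x [U _ <-].
by apply: nneseries_ge0 => n _ _; exact: diam_pow_ge0.
Qed.

Lemma hausdorff_null_dim E : (forall s, 0 < s -> hausdorff_null s E) ->
  hausdorff_dim E = 0%E.
Proof.
move=> nE; apply/eqP; rewrite eq_le; apply/andP; split.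
  apply/lee_addgt0Pr => e e0; rewrite add0e.
  apply: ereal_inf_lbound; exists e => //; split; first exact: ltW.
  by apply: hausdorff_null_measure => //; exact: nE.
by apply: le_ereal_inf_tmp => x [s [s0 _] <-]; rewrite lee_fin.
Qed.

Lemma sub_hausdorff_null s A E : A `<=` E ->
  hausdorff_null s E -> hausdorff_null s A.
Proof.
move=> AE nE e /nE[U [EU sU]]; exists U; split=> //; exact: subset_trans EU.
Qed.

Lemma hausdorff_null_bigcup_nat s (F : nat -> set R) :
  (forall i, hausdorff_null s (F i)) -> hausdorff_null s (\bigcup_i F i).
Proof.
move=> nF e e0.
have eps i : 0 < e / (2 ^ i.+1)%:R by rewrite divr_gt0 // ltr0n expn_gt0.
have /choice[U HU] : forall i, exists U : (set R)^nat, F i `<=` \bigcup_n U n /\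
  (\sum_(0 <= n <oo) diam_pow s (U n) <= (e / (2 ^ i.+1)%:R)%:E)%E.
  by move=> i; exact: nF.
have /card_esym/ppcard_eqP[f] := card_nat2.
exists (fun n => U (f n).1 (f n).2); split.
  move=> x [i _ /(HU i).1[j _ Ux]].
  have [n _ fn] : (f @` setT) (i, j) by apply: (surj (f := f)).
  by exists n => //; rewrite fn.
rewrite nneseries_esumT; last by move=> n; exact: diam_pow_ge0.
rewrite -(@reindex_esum R _ _ setT setT f (fun k => diam_pow s (U k.1 k.2))) //; last first.
have -> : [set: nat * nat] = setT `*`` (fun=> setT) :> set (nat * nat).
  by apply/seteqP; split.
rewrite -(@esum_esum _ _ _ _ _ (fun i j => diam_pow s (U i j))); last first.
  by move=> i j _ _; exact: diam_pow_ge0.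
rewrite -nneseries_esumT; last first.
  by move=> n; apply: esum_ge0 => i _; exact: diam_pow_ge0.
apply: (le_trans _ (epsilon_trick0 xpredT (ltW e0))).
apply: lee_nneseries => i _.
  by move=> _; apply: esum_ge0 => j _; exact: diam_pow_ge0.
rewrite -nneseries_esumT; last by move=> n; exact: diam_pow_ge0.
exact: (HU i).2.
Qed.

Lemma hausdorff_null_bigcup s (T : countType) (F : T -> set R) E :
  (forall x, E x -> exists i, F i x) -> (forall i, hausdorff_null s (F i)) ->
  0 < s -> hausdorff_null s E.
Proof.
move=> EF nF s0; pose G n := if unpickle n is Some i then F i else set0.
apply: (@sub_hausdorff_null _ _ (\bigcup_n G n)).
  by move=> x /EF[i Fx]; exists (pickle i) => //; rewrite /G pickleK.
apply: hausdorff_null_bigcup_nat => n; rewrite /G; case: unpickle => [i|] //.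
move=> e e0; exists (fun=> set0); split=> //.
by rewrite eseries0 ?lee_fin ?ltW // => i _ _; rewrite /diam_pow eqxx.
Qed.

(** A maximal t-spaced list is a t-net. If no net existed, lists could be extended point by point up
    to length N + 1. *)
Lemma spaced_net t A (N : nat) :
  (forall l, spaced t l -> (forall x, x \in l -> A x) -> (size l <= N)%N) ->
  exists2 l : seq R, (size l <= N)%N &
    forall x, A x -> exists2 y, y \in l & `|x - y| < t.
Proof.
move=> AN; apply: contrapT => H.
suff [l [sl Al zl]] : exists l, [/\ spaced t l, forall x, x \in l -> A x & size l = N.+1].
  by have := AN l sl Al; rewrite zl ltnn.
elim: {-2}(N.+1) (leqnn N.+1) => [|m IH] mN; first by exists [::].
have [l [sl Al zl]] := IH (ltnW mN).
apply: contrapT => H'; apply: H; exists l; first by rewrite zl.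
move=> x Ax; apply: contrapT => H''; apply: H'; exists (x :: l); split.
- rewrite /spaced /= -/(spaced t l) sl andbT; apply/allP => y yl.
  by rewrite leNgt; apply/negP => xy; apply: H''; exists y.
- by move=> y; rewrite inE => /orP[/eqP->//|/Al].
- by rewrite /= zl.
Qed.

(** Intervals of radius t around a t-net cover A, and each has diameter at most 2 t. *)
Lemma spaced_hausdorff_null s A : 0 < s ->
  (forall e, 0 < e -> exists t (N : nat),
    [/\ 0 <= t, N%:R * (2 * t) `^ s <= e & forall l, spaced t l ->
        (forall x, x \in l -> A x) -> (size l <= N)%N]) ->
  hausdorff_null s A.
Proof.
move=> s0 H e /H[t [N [t0 Ne /spaced_net[l lN Al]]]].
pose U n := if (n < size l)%N then [set x | `|x - l`_n| < t] else set0.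
exists U; split.
  move=> x /Al[y yl xy]; exists (index y l) => //.
  by rewrite /U index_mem yl /= nth_index.
rewrite (@nneseries_split _ _ 0 (size l)); last by move=> k _; exact: diam_pow_ge0.
rewrite add0n [X in (_ + X)%E]eseries0 ?adde0; last first.
  by move=> i li _; rewrite /U ltnNge li /= /diam_pow eqxx.
apply: (@le_trans _ _ (\sum_(0 <= i < size l) ((2 * t) `^ s)%:E)%E).
  apply: lee_sum => i _; apply: diam_pow_le; [exact: ltW|exact: mulr_ge0|].
  move=> x y; rewrite /U; case: ifP => // _ /ltW xt /ltW yt.
  rewrite (le_trans (ler_distD l`_i _ _)) // mulrDl mul1r lerD // distrC //.
rewrite sumEFin lee_fin sumr_const_nat subn0 -[leLHS]mulr_natl.
by apply: le_trans Ne; rewrite ler_wpM2r ?powR_ge0 // ler_nat.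
Qed.

End HausdorffNull.

(** * Asymptotic periodicity *)

Section LocalContraction.
Context {R : realType}.
Implicit Types (A : set R) (e d c : R).

Lemma discrete_unit_interval_finite A e : 0 < e ->
  A `<=` unit_interval ->
  (forall x y, A x -> A y -> `|x - y| < e -> x = y) -> finite_set A.
Proof.
move=> e0 AI Ae.
pose N := (Num.truncn e^-1).+1.
(* A cell [i e, (i + 1) e) contains at most one point of A, and [g] picks it; 0 is the default for
   an empty cell. *)
pose g (i : nat) := xget 0 (A `&` [set x | Num.truncn (x / e) = i]).
apply: (@sub_finite_set _ _ (g @` `I_N)); last exact: finite_image.
move=> x Ax; have := AI _ Ax; rewrite /unit_interval /= in_itv /= => /andP[x0 x1].
have xe0 : 0 <= x / e by rewrite divr_ge0 // ltW.
exists (Num.truncn (x / e)).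
  rewrite /= /N ltnS; apply: le_truncn; rewrite ler_pdivrMr // mulVf ?gt_eqF //.
  exact: ltW.
rewrite /g; case: xgetP => [y _ [Ay Ey]|/(_ x)]; last by case.
apply: Ae => //; have /andP[] := truncn_itv xe0.
have /andP[y0 _] : 0 <= y < 1 by have := AI _ Ay; rewrite /unit_interval /= in_itv.
have ye0 : 0 <= y / e by rewrite divr_ge0 // ltW.
have /andP[] := truncn_itv ye0; rewrite Ey -natr1.
set n := (_%:R); rewrite !ler_pdivlMr // !ltr_pdivrMr // ltr_norml.
move=> *; apply/andP; split; nra.
Qed.

(** Otherwise [u] would be injective with a discrete, hence finite, range. *)
Lemma exists_close_terms (u : nat -> R) e : 0 < e ->
  (forall n, unit_interval (u n)) ->
  exists i j, (i < j)%N /\ `|u i - u j| < e.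
Proof.
move=> e0 uI; apply: contrapT => H.
have far i j : `|u i - u j| < e -> i = j.
  move=> ij; apply: contrapT => /eqP; rewrite neq_ltn => /orP[] lt_ij; apply: H.
    by exists i, j.
  by exists j, i; rewrite distrC.
have fin : finite_set (range u).
  apply: (discrete_unit_interval_finite e0); first by move=> _ [i _ <-].
  by move=> _ _ [i _ <-] [j _ <-] /far ->.
apply: infinite_nat; apply: sub_finite_set (finite_preimage _ fin).
  by move=> n _ /=; exists n.
move=> i j _ _ uij; apply: far; by rewrite uij subrr normr0.
Qed.

Lemma exists_expr_lt c d e : 0 <= c < 1 -> 0 < e ->
  exists N, forall n, (N <= n)%N -> c ^+ n * d < e.
Proof.
move=> /andP[c0 c1] e0.
have /cvgrPdist_lt/(_ (e / (`|d| + 1))) : (fun n => c ^+ n) @ \oo --> 0.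
  by apply: cvg_expr; rewrite ger0_norm.
have d1 : 0 < `|d| + 1 by rewrite ltr_wpDl.
rewrite divr_gt0 // => /(_ isT)[N _ HN]; exists N => n /HN /=.
rewrite sub0r normrN ger0_norm ?exprn_ge0 // ltr_pdivlMr // => H.
apply: le_lt_trans H; rewrite ler_wpM2l ?exprn_ge0 //.
by rewrite (le_trans (ler_norm _)) // lerDl.
Qed.

(** The intended [S] is the closure of the n-th image of the interval. Contraction is asked only at
    distances below d, as distant points may lie on different branches. *)
Variables (f : R -> R) (S : set R) (n : nat) (d c : R).
Hypotheses (fI : forall x, unit_interval x -> unit_interval (f x)).
Hypotheses (Scl : closed S) (SI : S `<=` unit_interval).
Hypotheses (fS : forall x, S x -> S (f x)).
Hypotheses (fnS : forall x, unit_interval x -> S (iter n f x)).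
Hypotheses (d0 : 0 < d) (c01 : 0 <= c < 1).
Hypotheses (fc : forall u v, S u -> S v -> `|u - v| < d ->
  `|f u - f v| <= c * `|u - v|).

Let c0 : 0 <= c. Proof. by case/andP: c01. Qed.
Let c1 : c < 1. Proof. by case/andP: c01. Qed.

Let iterI m x : unit_interval x -> unit_interval (iter m f x).
Proof. by move=> xI; elim: m => //= m; exact: fI. Qed.

Let iterS m x : S x -> S (iter m f x).
Proof. by move=> xS; elim: m => //= m; exact: fS. Qed.

Let iter_contraction m u v : S u -> S v -> `|u - v| < d ->
  `|iter m f u - iter m f v| <= c ^+ m * `|u - v|.
Proof.
move=> uS vS uv; elim: m => [|m IH]; first by rewrite expr0 mul1r.
rewrite /= exprS -mulrA; apply: le_trans (fc _ _ _) _; try exact: iterS.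
  apply: le_lt_trans IH _; apply: le_lt_trans uv.
  by rewrite ler_piMl // exprn_ile1 // ltW.
exact: ler_wpM2l.
Qed.

Let iter_period q m p : iter q f p = p -> iter (m * q) f p = p.
Proof.
by move=> qp; elim: m => // m IH; rewrite mulSn iterD IH.
Qed.

(** Running n times round the cycle exhibits p as an n-th image. *)
Let periodic_S q p : unit_interval p -> (0 < q)%N -> iter q f p = p -> S p.
Proof.
move=> pI q0 qp; rewrite -(iter_period n qp).
rewrite -(@subnK n (n * q)) ?leq_pmulr // addnC iterD; apply: fnS.
exact: iterI.
Qed.

(** After q q' steps both points are back, yet their distance has shrunk by a factor at most c <
    1. *)
Let periodic_eq q q' p p' : S p -> S p' -> (0 < q)%N -> (0 < q')%N ->
  iter q f p = p -> iter q' f p' = p' -> `|p - p'| < d -> p = p'.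
Proof.
move=> pS pS' q0 q0' qp qp' pp'.
have := iter_contraction (q * q') pS pS' pp'.
rewrite {1}mulnC !iter_period // => H; apply/eqP; rewrite -subr_eq0 -normr_eq0.
have cq : c ^+ (q * q') <= c.
  by rewrite -{2}(expr1 c) ler_wiXn2l // ?muln_gt0 ?q0 // ltW.
have y0 := normr_ge0 (p - p').
have {}H : `|p - p'| <= c * `|p - p'| := le_trans H (ler_wpM2r y0 cq).
rewrite eq_le y0 andbT; move: c1 H; nra.
Qed.

(** The orbit returns close to one of its points y after q steps; then the q-th iterate maps a small
    closed ball of [S] around y into itself, and Banach's theorem gives the periodic point P. *)
Let exists_shadow x : unit_interval x -> exists i q P,
  [/\ (0 < q)%N, S (iter i f x), S P, iter q f P = P & `|iter i f x - P| < d].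
Proof.
move=> xI.
have [r r0 rd] : exists2 r : R, 0 < r & r + r < d.
  by exists (d / 3); [rewrite divr_gt0|move: d0 => d0'; lra].
(* The return error (1 - c) r and the contracted radius c r add up to r, so the ball is
   preserved. *)
have e0 : 0 < (1 - c) * r by rewrite mulr_gt0 // subr_gt0.
have [i [j [ij close]]] := exists_close_terms e0 (fun m => iterI m (SI (fnS xI))).
pose y := iter i f (iter n f x); pose q := (j - i)%N.
have q0 : (0 < q)%N by rewrite subn_gt0.
have yS : S y by apply: iterS; exact: fnS.
have gy : `|iter q f y - y| < (1 - c) * r.
  by rewrite /y -iterD subnK 1?ltnW // distrC.
pose U : set R := S `&` [set u | `|u - y| <= r].
have UU u v : U u -> U v -> `|u - v| < d.
  move=> [_ uy] [_ vy]; rewrite (le_lt_trans (ler_distD y _ _)) // [`|y - _|]distrC.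
  rewrite /= in uy vy; exact: le_lt_trans (lerD uy vy) rd.
have cq : c ^+ q <= c by rewrite -{2}(expr1 c) ler_wiXn2l // ltW.
have gUU : {homo iter q f : u / U u >-> U u}.
  move=> u Uu; have [uS /= uy] := Uu; split; first exact: iterS.
  rewrite /= (le_trans (ler_distD (iter q f y) _ _)) //.
  have Uy : U y by split=> //=; rewrite subrr normr0 ltW.
  have := iter_contraction q uS yS (UU _ _ Uu Uy).
  have : c ^+ q * `|u - y| <= c * r by rewrite ler_pM ?exprn_ge0.
  move: gy; nra.
have Ucl : closed U.
  apply: closedI => //.
  have -> : [set u | `|u - y| <= r] = `[y - r, y + r]%classic.
    by apply/seteqP; split=> u /=; rewrite in_itv /= ler_distl.
  exact: interval_closed.
have cq0 : 0 <= c ^+ q by exact: exprn_ge0.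
have ctr : is_contraction (mkfun gUU : {fun U >-> U}).
  exists (NngNum cq0); split=> /=; first exact: le_lt_trans c1.
  move=> [u v] [/= Uu Uv]; apply: iter_contraction.
  - exact: Uu.1. - exact: Uv.1. - exact: UU.
have [|P [PS Py] PP] := banach_fixed_point ctr Ucl.
  by exists y; split=> //=; rewrite subrr normr0 ltW.
exists (i + n)%N, q, P; rewrite iterD -/y; split=> //.
rewrite distrC; move: Py => /= /le_lt_trans; apply; apply: lt_trans rd.
by rewrite ltrDl.
Qed.

(** The orbits of [iter i f x] and P approach each other geometrically, so they have the same
    accumulation points; the finite orbit of P is closed. *)
Let omega_limit_shadow x i q P : unit_interval x -> (0 < q)%N ->
  S (iter i f x) -> S P -> iter q f P = P -> `|iter i f x - P| < d ->
  omega_limit unit_interval f x = range (fun m => iter m f P).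
Proof.
move=> xI q0 yS PS qP yP; apply/seteqP; split=> z.
- move=> [zI zcl]; apply: contrapT => zr.
  have fin : finite_set (range (fun m => iter m f P)).
    apply: (@sub_finite_set _ _ ((fun m => iter m f P) @` `I_q)); last exact: finite_image.
    move=> _ [m _ <-]; exists (m %% q)%N; first by rewrite /= ltn_mod.
    by rewrite {2}(divn_eq m q) addnC iterD iter_period.
  have cl : closed (range (fun m => iter m f P)).
    by apply: (accessible_finite_set_closed.1 _) fin; exact/hausdorff_accessible/Rhausdorff.
  have : nbhs z (~` range (fun m => iter m f P)).
    by apply: open_nbhs_nbhs; split=> //; exact: closed_openC.
  move=> /nbhs_ballP[e /= e0 ze].
  have e20 : 0 < e / 2 by rewrite divr_gt0.
  have [N HN] := exists_expr_lt d c01 e20.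
  have [] := zcl [set u | exists2 m, (N + i <= m)%N & u = iter m f x] (ball z (e / 2)).
  + by exists (N + i)%N => // m Nm; exists m.
  + exact: nbhsx_ballx.
  move=> _ [[m Nm ->] zm].
  have im : (i <= m)%N by apply: leq_trans Nm; exact: leq_addl.
  apply: (ze (iter (m - i) f P)); last by exists (m - i)%N.
  rewrite -ball_normE /=; move: zm; rewrite -ball_normE /= => zm.
  rewrite (le_lt_trans (ler_distD (iter m f x) _ _)) // (splitr e) ltrD //.
  rewrite -{1}(subnK im) iterD.
  apply: le_lt_trans (iter_contraction _ yS PS yP) _.
  apply: le_lt_trans (HN (m - i)%N _); last by rewrite leq_subRL // addnC.
  by rewrite ler_wpM2l ?exprn_ge0 // ltW.
- move=> [r _ <-]; split; first exact/SI/iterS.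
  move=> A B [N _ NA] /nbhs_ballP[e /= e0 eB].
  have [M HM] := exists_expr_lt d c01 e0.
  (* A time congruent to r modulo the period: M makes the orbits close, N reaches the prescribed
     tail. *)
  pose m := (r + (M + N) * q)%N.
  have Mm : (M + N <= m)%N.
    by rewrite /m (leq_trans (leq_pmulr (M + N)%N q0)) // leq_addl.
  exists (iter (m + i) f x); split.
    apply: NA; rewrite /= (leq_trans _ (leq_addr _ _)) // (leq_trans _ Mm) //.
    exact: leq_addl.
  apply: eB; rewrite -ball_normE /= distrC iterD.
  have -> : iter r f P = iter m f P by rewrite /m iterD iter_period.
  apply: le_lt_trans (iter_contraction _ yS PS yP) _.
  apply: le_lt_trans (HM m _); last by rewrite (leq_trans _ Mm) // leq_addr.
  by rewrite ler_wpM2l ?exprn_ge0 // ltW.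
Qed.

Lemma local_contraction_asymptotically_periodic :
  asymptotically_periodic unit_interval f.
Proof.
split.
  move=> x xI; have [i [q [P [q0 yS PS qP yP]]]] := exists_shadow xI.
  rewrite (omega_limit_shadow xI q0 yS PS qP yP).
  by exists P, q; split=> //; exact: SI.
pose Per := [set p : R | unit_interval p /\ exists2 q, (0 < q)%N & iter q f p = p].
exists ((fun p => range (fun m => iter m f p)) @` Per); split.
- apply: finite_image; apply: (discrete_unit_interval_finite d0) => [p []//|].
  move=> p p' [pI [q q0 qp]] [pI' [q' q0' qp']].
  by apply: (periodic_eq _ _ q0 q0' qp qp') => //; [exact: periodic_S _ q0 qp|exact: periodic_S _ q0' qp'].
- by move=> _ [p [pI [q q0 qp]] <-]; exists p, q.
- apply/seteqP; split=> z.
    move=> [x xI]; have [i [q [P [q0 yS PS qP yP]]]] := exists_shadow xI.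
    rewrite (omega_limit_shadow xI q0 yS PS qP yP) => zP.
    exists (range (fun m => iter m f P)) => //; exists P => //; split; first exact: SI.
    by exists q.
  move=> [_ [p [pI [q q0 qp]] <-] zp]; exists p => //.
  have pS : S p by exact: periodic_S qp.
  by rewrite (@omega_limit_shadow p 0 q p) //= subrr normr0.
Qed.

End LocalContraction.

(** * Coding of orbits *)

Lemma unit_intervalE (R : realType) (x : R) : unit_interval x <-> 0 <= x < 1.
Proof. by rewrite /unit_interval /= in_itv. Qed.

Lemma mod1_unit_interval (R : realType) (x : R) : unit_interval (mod1 x).
Proof.
apply/unit_intervalE; have /andP[] := floor_itv x.
rewrite /mod1 intrD; move: (_%:~R) => y *; apply/andP; split; lra.
Qed.

Lemma mod1_unique (R : realType) (x y : R) (M : int) :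
  unit_interval y -> x = y + M%:~R -> mod1 x = y.
Proof.
move=> /unit_intervalE/andP[y0 y1] ->; rewrite /mod1 (@floor_def _ _ M) ?addrK //.
by rewrite intrD; apply/andP; split; lra.
Qed.

(** * Breakpoints and the pieces between them *)

Section Breakpoints.
Context {R : realType} {k : nat} (a : 'rV[R]_k.+1).
Hypothesis ha : partition_points a.
Local Notation bp := (breakpoint a).

Lemma breakpoint_ord (i : 'I_k.+1) : bp i = a ord0 i.
Proof. by rewrite /breakpoint valK. Qed.

Lemma breakpoint_first : bp 0 = 0.
Proof.
by have [a0 _ _] := ha; rewrite -[0%N]/(val (@ord0 k)) breakpoint_ord a0.
Qed.

Lemma breakpoint_last : bp k.+1 = 1.
Proof. by rewrite /breakpoint insubF // ltnn. Qed.

Lemma breakpoint_lt i j : (i < j <= k.+1)%N -> bp i < bp j.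
Proof.
case: ha => _ amono a1 /andP[ij]; rewrite leq_eqVlt => /orP[/eqP jk|jk].
  have ik : (i < k.+1)%N by rewrite -jk.
  rewrite jk breakpoint_last; rewrite -[i]/(val (Ordinal ik)) breakpoint_ord; exact: a1.
have ik := ltn_trans ij jk.
rewrite -[i]/(val (Ordinal ik)) -[j]/(val (Ordinal jk)) !breakpoint_ord.
exact: amono.
Qed.

Lemma breakpoint_le i j : (i <= j <= k.+1)%N -> bp i <= bp j.
Proof.
rewrite leq_eqVlt => /andP[/orP[/eqP->//|ij] jk].
by apply/ltW/breakpoint_lt; rewrite ij.
Qed.

Definition letter (x : R) : 'I_k.+1 :=
  odflt ord0 [pick i : 'I_k.+1 | bp i <= x < bp i.+1].

Lemma exists_piece x : unit_interval x -> exists i : 'I_k.+1, bp i <= x < bp i.+1.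
Proof.
move=> /unit_intervalE/andP[x0 x1].
have ex : exists m, (m <= k.+1)%N && (x < bp m).
  by exists k.+1; rewrite leqnn breakpoint_last.
case: (ex_minnP ex) => -[|m] /andP[mk xm] mmin.
  by move: xm; rewrite breakpoint_first ltNge x0.
exists (Ordinal mk); rewrite /= xm andbT leNgt; apply/negP => xm'.
by have := mmin m; rewrite xm' (ltnW mk) ltnn => /(_ isT).
Qed.

Lemma letterP x : unit_interval x -> bp (letter x) <= x < bp (letter x).+1.
Proof.
move=> /exists_piece[i xi]; rewrite /letter; case: pickP => [//|/(_ i)].
by rewrite xi.
Qed.

(** The left end of the piece containing the larger point separates the two points. *)
Lemma letter_neq_breakpoint u v : unit_interval u -> unit_interval v ->
  letter u != letter v ->
  exists2 i : 'I_k.+2, `|u - bp i| <= `|u - v| & `|v - bp i| <= `|u - v|.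
Proof.
wlog uv : u v / u <= v.
  move=> W uI vI ne; have [uv|/ltW vu] := leP u v; first exact: W.
  have [|i iu iv] := W v u vu vI uI; first by rewrite eq_sym.
  by exists i; rewrite [leRHS]distrC.
move=> uI vI ne.
have /andP[u1 u2] := letterP uI; have /andP[v1 v2] := letterP vI.
have lt : (letter u < letter v)%N.
  rewrite ltn_neqAle ne /= leqNgt; apply/negP => vu.
  have := breakpoint_le (i := (letter v).+1) (j := letter u).
  rewrite vu ltnW //= => /(_ isT); lra.
have uj : u < bp (letter v).
  apply: lt_le_trans u2 _; apply: breakpoint_le; rewrite lt /= ltnW //.
have lk : (letter v < k.+2)%N by exact: leqW (ltn_ord (letter v)).
exists (Ordinal lk) => /=; rewrite [`|u - v|]distrC [`|v - u|]ger0_norm ?subr_ge0 //.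
  by rewrite distrC ger0_norm; lra.
by rewrite ger0_norm; lra.
Qed.

End Breakpoints.

(** * Branches, carries and codes of orbits *)

Section Coding.
Context {R : realType} {k : nat} (a b : 'rV[R]_k.+1).
Hypothesis ha : partition_points a.
Local Notation bp := (breakpoint a).
Local Notation f := (pw_map a b).
Local Notation A := ('I_k.+1 * bool)%type.
Implicit Types (lam x : R).

(* The carry of lam x + b_c modulo 1; since 0 <= lam x < 1 it is 0 or 1. *)
Definition carry lam x : bool :=
  1 <= lam * x + mod1 (b ord0 (letter a x)).

(** Reducing b modulo 1 first leaves finitely many translations, bounded by 1 and the same for all
    lambda. *)
Definition translation (e : A) : R := mod1 (b ord0 e.1) - e.2%:R.

Definition step_letter lam x : A := (letter a x, carry lam x).

Lemma pw_map_letter lam x : unit_interval x ->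
  f lam x = mod1 (lam * x + b ord0 (letter a x)).
Proof.
move=> xI; rewrite /pw_map /affine_lift /letter; case: pickP => [//|/= H].
by have [i] := exists_piece ha xI; rewrite H.
Qed.

Lemma pw_map_unit_interval lam x : unit_interval (f lam x).
Proof. exact: mod1_unit_interval. Qed.

(** With b reduced modulo 1 the lift lies in [0, 2), so its integer part is the carry. *)
Lemma pw_mapE lam x : 0 <= lam <= 1 -> unit_interval x ->
  f lam x = lam * x + translation (step_letter lam x).
Proof.
move=> /andP[l0 l1] xI; rewrite pw_map_letter //.
have /unit_intervalE/andP[x0 x1] := xI.
have lx0 : 0 <= lam * x by rewrite mulr_ge0.
have lx1 : lam * x < 1 by nra.
rewrite /translation /step_letter /carry /=; set B := b ord0 _.
have /unit_intervalE/andP[B0 B1] := mod1_unit_interval B.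
apply: (@mod1_unique _ _ _ (Num.floor B + (1 <= lam * x + mod1 B)%R%:Z)).
  by apply/unit_intervalE; case: (leP 1 (lam * x + mod1 B)) => /= h; apply/andP; split; lra.
have BE : B = mod1 B + (Num.floor B)%:~R by rewrite /mod1 subrK.
by rewrite {1}BE intrD; case: leP => _ /=; lra.
Qed.

Lemma translation_le1 e : `|translation e| <= 1.
Proof.
rewrite /translation; set B := b ord0 _.
have /unit_intervalE/andP[B0 B1] := mod1_unit_interval B.
by rewrite ler_norml; case: e.2 => /=; apply/andP; split; lra.
Qed.

(** No breakpoint fits between u and v, so they share a branch; the image of v is at least d away
    from 0 and 1, so the shift crosses no integer. *)
Lemma pw_map_shift lam u v d : 0 <= lam <= 1 -> 0 < d ->
  unit_interval u -> unit_interval v ->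
  (forall i : 'I_k.+2, d <= `|u - bp i|) -> 
  (forall i : 'I_k.+2, d <= `|f lam v - bp i|) -> 
  `|u - v| < d -> f lam u = f lam v + lam * (u - v).
Proof.
move=> /andP[l0 l1] d0 uI vI ud fvd uv.
have uv_letter : letter a u = letter a v.
  apply/eqP/negPn/negP => /(letter_neq_breakpoint ha uI vI)[i ui _].
  by have := le_lt_trans (le_trans (ud i) ui) uv; rewrite ltxx.
rewrite (pw_map_letter _ uI) uv_letter.
set B := b ord0 _.
have fvE : lam * v + B = f lam v + (Num.floor (lam * v + B))%:~R.
  by rewrite pw_map_letter // -/B /mod1 subrK.
apply: (mod1_unique (M := Num.floor (lam * v + B))); last first.
  by move: fvE; move: (_%:~R) (f lam v) => M F; lra.
have /unit_intervalE/andP[w0 w1] := pw_map_unit_interval lam v.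
have := fvd ord_max; rewrite /= breakpoint_last ler0_norm; last by lra.
have := fvd ord0; rewrite /= breakpoint_first // subr0 ger0_norm // => h0 h1.
have : `|lam * (u - v)| < d.
  by rewrite normrM ger0_norm // (le_lt_trans _ uv) // ler_piMl.
rewrite ltr_norml => /andP[h2 h3]; apply/unit_intervalE; apply/andP; split; lra.
Qed.

(** The gap passes to the closure of the n-th image. The closure stays inside [0, 1) because 1 is
    itself a breakpoint. *)
Lemma gap_asymptotically_periodic lam n d : 0 < lam < 1 -> 0 < d ->
  (forall x, unit_interval x -> forall i : 'I_k.+2, d <= `|iter n (f lam) x - bp i|) ->
  asymptotically_periodic unit_interval (f lam).
Proof.
move=> /andP[l0 l1] d0 gap.
have l01 : 0 <= lam <= 1 by rewrite !ltW.
have iterI m x : unit_interval x -> unit_interval (iter m (f lam) x).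
  by case: m => // m _ /=; exact: pw_map_unit_interval.
pose D := iter n (f lam) @` unit_interval.
have near_D u e : closure D u -> 0 < e -> exists2 z, D z & `|u - z| < e.
  move=> /(_ (ball u e)) H e0; have [|z [Dz]] := H; first exact: nbhsx_ballx.
  by rewrite -ball_normE /= => uz; exists z.
have DI z : D z -> unit_interval z by move=> [x xI <-]; exact: iterI.
have fD z : D z -> D (f lam z).
  move=> [x xI <-]; exists (f lam x); first exact: pw_map_unit_interval.
  by rewrite -iterS -iterSr.
have gapS u : closure D u -> forall i : 'I_k.+2, d <= `|u - bp i|.
  move=> uD i; apply/ler_addgt0Pr => e e0; have [z [x xI <-] uz] := near_D _ _ uD e0.
  rewrite (le_trans (gap x xI i)) // (le_trans (ler_distD u _ _)) // addrC lerD2l.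
  by rewrite distrC ltW.
have SI : closure D `<=` unit_interval.
  move=> u uD; apply/unit_intervalE.
  have u0 : 0 <= u.
    apply/ler_addgt0Pr => e e0; have [z Dz] := near_D _ _ uD e0.
    by have /unit_intervalE/andP[] := DI _ Dz; rewrite ltr_norml => *; lra.
  have u1 : u <= 1.
    apply/ler_addgt0Pr => e e0; have [z Dz] := near_D _ _ uD e0.
    by have /unit_intervalE/andP[] := DI _ Dz; rewrite ltr_norml => *; lra.
  rewrite u0 lt_neqAle u1 andbT; apply/eqP => ue1.
  by have := gapS _ uD ord_max; rewrite /= breakpoint_last ue1 subrr normr0 leNgt d0.
(* The map may jump elsewhere, but by [pw_map_shift] it is Lipschitz at distances below d here. *)
have fS u : closure D u -> closure D (f lam u).
  move=> uD B /nbhs_ballP[e /= e0 eB].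
  have m0 : 0 < Num.min e d by rewrite lt_min e0.
  have [z Dz] := near_D _ _ uD m0; rewrite lt_min => /andP[uze uzd].
  exists (f lam z); split; first exact: fD.
  apply: eB; rewrite -ball_normE /=.
  rewrite (@pw_map_shift lam u z d) //; [|exact: SI|exact: DI|exact: gapS|].
    rewrite addrAC subrr add0r normrM ger0_norm ?(ltW l0) // (le_lt_trans _ uze) //.
    by rewrite ler_piMl // ltW.
  by apply: gapS; apply: subset_closure; exact: fD.
apply: (@local_contraction_asymptotically_periodic _ _ (closure D) n d lam) => //.
- by move=> x _; exact: pw_map_unit_interval.
- exact: closed_closure.
- by move=> x xI; apply: subset_closure; exists x.
- by rewrite ltW.
- move=> u v uD vD uv.
  rewrite (@pw_map_shift lam u v d) //; [|exact: SI|exact: SI|exact: gapS|].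
    by rewrite addrAC subrr add0r normrM ger0_norm // ltW.
  by apply: gapS; exact: fS.
Qed.

Lemma exceptional_near_breakpoint lam n e : exceptional_set a b lam -> 0 < e ->
  exists x (i : 'I_k.+2), unit_interval x /\ `|iter n (f lam) x - bp i| < e.
Proof.
move=> [l01 H] e0; apply: contrapT => nex; apply: H.
apply: (@gap_asymptotically_periodic lam n e) => // x xI i.
by rewrite leNgt; apply/negP => h; apply: nex; exists x, i.
Qed.

Definition affine_word lam x (v : seq A) : R :=
  foldl (fun y e => lam * y + translation e) x v.

Definition step_word lam x n : seq A :=
  mkseq (fun j => step_letter lam (iter j (f lam) x)) n.

Lemma iter_affine_word lam x n : 0 <= lam <= 1 -> unit_interval x ->
  iter n (f lam) x = affine_word lam x (step_word lam x n).
Proof.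
move=> l01 xI; elim: n => [//|n IH].
rewrite /step_word mkseqS /affine_word foldl_rcons -/(affine_word _ _ _) -IH /=.
rewrite pw_mapE //; by case: (n) => // m; exact: pw_map_unit_interval.
Qed.

Lemma affine_word_dist lam x y v : 0 <= lam ->
  `|affine_word lam x v - affine_word lam y v| = lam ^+ size v * `|x - y|.
Proof.
move=> l0; elim/last_ind: v => [|v e IH]; first by rewrite expr0 mul1r.
rewrite /affine_word !foldl_rcons size_rcons exprS -mulrA -IH.
rewrite opprD addrACA subrr addr0 -mulrBr normrM ger0_norm //.
Qed.

Definition word_poly x (v : seq A) : {poly R} :=
  foldl (fun p e => p * 'X + (translation e)%:P) x%:P v.

Lemma horner_word_poly lam x v : (word_poly x v).[lam] = affine_word lam x v.
Proof.
elim/last_ind: v => [|v e IH]; first by rewrite hornerC.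
by rewrite /word_poly /affine_word !foldl_rcons !hornerE IH mulrC.
Qed.

(** Each step multiplies all that precedes by X. Through this coefficient, Z-independence keeps word
    polynomials away from breakpoints at 0. *)
Lemma coef0_word_poly x v e : (word_poly x (rcons v e))`_0 = translation e.
Proof. by rewrite /word_poly foldl_rcons coefD coefMX coefC add0r. Qed.

Lemma coef_word_poly_le x v i : `|x| <= 1 -> `|(word_poly x v)`_i| <= 1.
Proof.
move=> x1; elim/last_ind: v i => [|v e IH] i.
  by rewrite coefC; case: eqP => // _; rewrite normr0.
rewrite /word_poly foldl_rcons coefD coefMX coefC; case: i => [|i] /=.
  by rewrite add0r translation_le1.
by rewrite addr0; exact: IH.
Qed.

(* The letter at time n also records the carry of the previous step, so that two
   orbits whose codes agree before n have close lifts at time n. *)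
Definition orbit_code lam x n : A :=
  (letter a (iter n (f lam) x),
   if n is m.+1 then carry lam (iter m (f lam) x) else false).

Lemma step_word_code lam lam' x x' n :
  (forall i, (i < n.+1)%N -> orbit_code lam x i = orbit_code lam' x' i) ->
  step_word lam x n = step_word lam' x' n.
Proof.
move=> E; apply/eq_in_map => i; rewrite mem_iota add0n => /andP[_ ni].
have [e1 _] := E i (ltnW ni); have [_ e2] := E i.+1 ni.
by rewrite /step_letter e1 e2.
Qed.

(** A parameter error eta enters at each step; eta / (1 - r) is the fixed point of z -> r z + eta,
    so only the part e contracts. *)
Lemma mul_dist lam lam' y y' r eta e : 0 <= lam <= r -> 0 <= y' <= 1 -> r < 1 ->
  `|lam - lam'| <= eta -> `|y - y'| <= e + eta / (1 - r) ->
  `|lam * y - lam' * y'| <= r * e + eta / (1 - r).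
Proof.
move=> /andP[l0 lr] /andP[y0 y1] r1 ll yy.
have -> : lam * y - lam' * y' = lam * (y - y') + (lam - lam') * y' by ring.
rewrite (le_trans (ler_normD _ _)) // !normrM (ger0_norm l0) (ger0_norm y0).
have h1 : lam * `|y - y'| <= r * (e + eta / (1 - r)) by rewrite ler_pM.
have h2 : `|lam - lam'| * y' <= eta by rewrite -[leRHS]mulr1 ler_pM.
apply: le_trans (lerD h1 h2) _; rewrite le_eqVlt; apply/orP; left; apply/eqP.
by field; rewrite subr_eq0 gt_eqF.
Qed.

Lemma iter_unit_interval lam x n : unit_interval x ->
  unit_interval (iter n (f lam) x).
Proof. by case: n => // n _ /=; exact: pw_map_unit_interval. Qed.

(** * Codes of orbits at two nearby parameters *)

Section TwoOrbits.
Variables (lam lam' x x' r eta : R).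
Hypotheses (lr : 0 <= lam <= r) (lr' : 0 <= lam' <= r) (r1 : r < 1).
Hypotheses (xI : unit_interval x) (xI' : unit_interval x').
Hypothesis ll : `|lam - lam'| <= eta.

Let l01 : 0 <= lam <= 1.
Proof. by have /andP[-> /le_trans->//] := lr; exact: ltW. Qed.
Let l01' : 0 <= lam' <= 1.
Proof. by have /andP[-> /le_trans->//] := lr'; exact: ltW. Qed.
Let eta0 : 0 <= eta. Proof. exact: le_trans ll. Qed.

Let iter01 n : 0 <= iter n (f lam') x' <= 1.
Proof.
have /unit_intervalE/andP[-> h] := iter_unit_interval lam' n xI'.
exact: ltW.
Qed.

Lemma code_dist n : (forall i, (i < n.+1)%N -> orbit_code lam x i = orbit_code lam' x' i) ->
  `|iter n (f lam) x - iter n (f lam') x'| <= r ^+ n + eta / (1 - r).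
Proof.
elim: n => [_|n IH E].
  rewrite expr0 /= (@le_trans _ _ 1) // ?lerDl; last first.
    by rewrite divr_ge0 // subr_ge0 ltW.
  have /unit_intervalE/andP[x0 x1] := xI; have /unit_intervalE/andP[y0 y1] := xI'.
  by rewrite ler_norml; apply/andP; split; lra.
have [e1 _] := E n (leqW (leqnn _)); have [_ e2] := E n.+1 (leqnn _).
rewrite /= !pw_mapE //; try exact: iter_unit_interval.
rewrite /step_letter e1 e2 opprD addrACA subrr addr0 exprS.
by apply: mul_dist => //; apply: IH => i ni; apply: E; exact: ltnW.
Qed.

(** The lifts are still close. Different carries put them on the two sides of 1, so the iterate is
    near 0 or 1; equal carries leave different letters, hence a breakpoint between the iterates. *)
Lemma code_split n : (forall i, (i < n.+1)%N -> orbit_code lam x i = orbit_code lam' x' i) ->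
  orbit_code lam x n.+1 <> orbit_code lam' x' n.+1 ->
  exists i : 'I_k.+2, `|iter n.+1 (f lam) x - bp i| <= r ^+ n + eta / (1 - r).
Proof.
move=> E ne; have [e1 _] := E n (leqnn _).
have {}E := code_dist E.
set e := r ^+ n + _ in E *.
have r0 : 0 <= r by have /andP[/le_trans h /h] := lr.
set y := iter n (f lam) x in E e1; set y' := iter n (f lam') x' in E e1.
pose B := mod1 (b ord0 (letter a y)).
have uu : `|(lam * y + B) - (lam' * y' + B)| <= e.
  rewrite opprD addrACA subrr addr0 (le_trans (mul_dist lr (iter01 n) r1 ll E)) //.
  by rewrite lerD2r ler_piMl ?exprn_ge0 // ltW.
have yE : iter n.+1 (f lam) x = lam * y + B - (carry lam y)%:R.
  by rewrite /= pw_mapE //; [rewrite addrA|exact: iter_unit_interval].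
have yE' : iter n.+1 (f lam') x' = lam' * y' + B - (carry lam' y')%:R.
  by rewrite /= pw_mapE //; [rewrite addrA /B e1|exact: iter_unit_interval].
have wI := iter_unit_interval lam n.+1 xI.
have wI' := iter_unit_interval lam' n.+1 xI'.
have [cc|cc] := eqVneq (carry lam y) (carry lam' y'); last first.
  have cE : carry lam y = (1 <= lam * y + B) by [].
  have cE' : carry lam' y' = (1 <= lam' * y' + B) by rewrite /carry -e1.
  move: uu cc; rewrite yE cE cE'; set u := _ + B; set u' := _ + B.
  have := wI; rewrite yE cE -/u => /unit_intervalE.
  rewrite ler_norml => /andP[].
  case: (leP 1 u) => hu; case: (leP 1 u') => hu' //= h0 h1 /andP[h2 h3] _.
    exists ord0; rewrite /= breakpoint_first // subr0 ger0_norm; lra.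
  exists ord_max; rewrite /= breakpoint_last ler0_norm; lra.
have [|i iy _] := letter_neq_breakpoint ha wI wI'.
  apply/eqP => lL; apply: ne; rewrite /orbit_code lL; congr (_, _); exact: cc.
exists i; rewrite (le_trans iy) //.
by rewrite yE yE' cc opprD addrACA subrr addr0.
Qed.

End TwoOrbits.

(* All words v are allowed, not only itineraries at lam, so that for each p the
   condition can fail for every delta only at roots of finitely many polynomials. *)
Definition separated_breakpoints (p : nat) (delta lam : R) : Prop :=
  forall (v : seq A) (i j : 'I_k.+2), (0 < size v < p)%N ->
    2 * delta < `|affine_word lam (bp i) v - bp j|.

(** At both splitting times the orbit of [x1] is within delta of a breakpoint, so the m steps in
    between carry one breakpoint to within 2 delta of another. *)
Lemma code_sparse p delta r eta n0 (lam1 lam2 lam3 x1 x2 x3 : R) j m :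
    0 <= lam1 <= r -> 0 <= lam2 <= r -> 0 <= lam3 <= r -> r < 1 ->
    unit_interval x1 -> unit_interval x2 -> unit_interval x3 ->
    `|lam1 - lam2| <= eta -> `|lam1 - lam3| <= eta ->
    r ^+ n0 + eta / (1 - r) <= delta -> separated_breakpoints p delta lam1 ->
    (n0 < j)%N -> (0 < m < p)%N ->
    (forall i, (i < j)%N -> orbit_code lam1 x1 i = orbit_code lam2 x2 i) ->
    orbit_code lam1 x1 j <> orbit_code lam2 x2 j ->
    (forall i, (i < j + m)%N -> orbit_code lam1 x1 i = orbit_code lam3 x3 i) ->
    orbit_code lam1 x1 (j + m) <> orbit_code lam3 x3 (j + m) -> False.
Proof.
move=> l1 l2 l3 r1 I1 I2 I3 l12 l13 dr sep nj mp E2 N2 E3 N3.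
have /andP[r0 _] : 0 <= r <= 1 by have /andP[/le_trans h /h->] := l1; rewrite ltW.
have l01 : 0 <= lam1 <= 1 by have /andP[-> /le_trans->//] := l1; exact: ltW.
have near_delta n : (n0 <= n)%N -> r ^+ n + eta / (1 - r) <= delta.
  by move=> nn; apply: le_trans dr; rewrite lerD2r ler_wiXn2l // ltW.
case: j nj E2 N2 E3 N3 => // j nj E2 N2 E3 N3.
have [i /le_trans/(_ (near_delta _ nj)) yi] := code_split l1 l2 r1 I1 I2 l12 E2 N2.
have [i'] := code_split (n := (j + m)%N) l1 l3 r1 I1 I3 l13 E3 N3.
move=> /le_trans/(_ (near_delta _ (leq_trans nj (leq_addr _ _)))).
rewrite -addSn addnC iterD iter_affine_word //; last exact: iter_unit_interval.
set y := iter j.+1 _ _ in yi *; set v := step_word _ _ _ => yi'.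
have sv : size v = m by rewrite size_mkseq.
have /(sep v i i') : (0 < size v < p)%N by rewrite sv.
apply/negP; rewrite -leNgt.
rewrite (le_trans (ler_distD (affine_word lam1 y v) _ _)) //.
rewrite mulrDl mul1r lerD // distrC affine_word_dist; last by case/andP: l01.
apply: le_trans yi; rewrite ler_piMl // exprn_ile1; by case/andP: l01.
Qed.

End Coding.

(** * The exceptional set *)

Lemma sqnorm_scaled_le (R : realFieldType) (p : {poly R}) (r B : R) :
  0 <= r < 1 -> (forall i, `|p`_i| <= B) ->
  sqnorm (\poly_(i < size p) (p`_i * r ^+ i)) <= (B / (1 - r ^+ 2)) ^+ 2.
Proof.
move=> /andP[r0 r1] pB; rewrite (sqnorm_widen (size_poly _ _)).
have B0 : 0 <= B by apply: le_trans (pB 0%N).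
have r2 : 0 <= r ^+ 2 < 1 by rewrite exprn_ge0 // exprn_ilt1.
have /andP[r20 r21] := r2.
apply: (@le_trans _ _ (\sum_(i < size p) B ^+ 2 * (r ^+ 2) ^+ i)).
  apply: ler_sum => i _; rewrite coef_poly ltn_ord exprMn -!exprM mulnC.
  rewrite ler_wpM2r ?exprn_ge0 // -[leLHS]real_normK ?num_real //.
  by rewrite ler_pXn2r ?nnegrE.
rewrite -mulr_sumr exprMn ler_wpM2l ?exprn_ge0 //.
set S := \sum_(_ < _) _; set x := r ^+ 2 in r2 r20 r21 S *.
have x1 : 0 < 1 - x by rewrite subr_gt0.
have S1 : S * (1 - x) <= 1.
  have := subrX1 x (size p); rewrite -/S => E.
  have -> : S * (1 - x) = 1 - x ^+ size p by move: E; move: (x ^+ size p) => y; lra.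
  by rewrite lerBlDr lerDl exprn_ge0.
have {}S1 : S <= (1 - x)^-1 by rewrite -[leRHS]mul1r ler_pdivlMr.
have x1i : 1 <= (1 - x)^-1 by rewrite invf_ge1 // lerBlDr lerDl.
(* As 1 / (1 - r^2) is at least 1, its square also bounds the series; this avoids a square root in
   the norm bound. *)
by apply: le_trans S1 _; rewrite expr2 ler_peMl // (le_trans ler01).
Qed.

(** Bounded coefficients become square-summable after replacing X by r X, and points up to r^2 move
    to points up to r; hence the range r^2. The spacing only grows. *)
Lemma coef0_le_small_values_scaled (R : realFieldType) (p : {poly R})
    (r t e B : R) (l : seq R) :
    0 < r < 1 -> 0 < t <= 1 -> 0 <= e -> (forall i, `|p`_i| <= B) ->
    spaced t l -> (forall x, x \in l -> 0 <= x <= r ^+ 2 /\ `|p.[x]| <= e) ->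
  `|p`_0| <= r ^+ size l * (B / (1 - r ^+ 2)) + (4 / t) ^+ size l * e.
Proof.
move=> /andP[r0 r1] t01 e0 pB sl pl.
pose q := \poly_(i < size p) (p`_i * r ^+ i).
have B0 : 0 <= B by apply: le_trans (pB 0%N).
have r2 : 0 < 1 - r ^+ 2 by rewrite subr_gt0 exprn_ilt1 // ltW.
have -> : p`_0 = q`_0.
  by rewrite coef_poly expr0 mulr1; case: ltnP => // /(nth_default 0).
rewrite -(size_map (fun x => x / r)).
apply: coef0_le_small_values => //.
- by rewrite !ltW.
- by rewrite divr_ge0 // ltW.
- by apply: sqnorm_scaled_le => //; rewrite ltW.
- rewrite /spaced pairwise_map; apply: sub_pairwise sl => x y /= xy.
  have ri : 1 <= r^-1 by rewrite invf_ge1 // ltW.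
  rewrite -mulrBl normrM [`|r^-1|]ger0_norm ?(le_trans ler01) //.
  by apply: le_trans xy _; rewrite ler_peMr.
- move=> _ /mapP[x /pl[/andP[x0 xr] px] ->]; split.
    by rewrite divr_ge0 ?ler_pdivrMr ?(ltW r0).
  suff -> : q.[x / r] = p.[x] by [].
  rewrite horner_poly horner_coef; apply: eq_bigr => i _.
  by rewrite -mulrA -exprMn mulrCA mulfV ?mulr1 // gt_eqF.
Qed.

Section Null.
Context {R : realType}.
Implicit Types (s e : R).

Lemma root_hausdorff_null s (q : {poly R}) : 0 < s -> q != 0 ->
  hausdorff_null s [set x | root q x].
Proof.
move=> s0 q0; apply: spaced_hausdorff_null => // e e0.
pose n : R := (size q)%:R + 1.
have n0 : 0 < n by rewrite ltr_wpDl.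
have en : 0 < e / n by rewrite divr_gt0.
(* Chosen so that (2 t)^s = e / n with n above the number of roots. *)
exists (2^-1 * (e / n) `^ s^-1), (size q); split.
- by rewrite mulr_ge0 // powR_ge0.
- rewrite mulrA mulfV // mul1r -powRrM mulVf ?gt_eqF // powRr1 ?(ltW en) //.
  rewrite mulrA ler_pdivrMr // mulrC ler_wpM2l ?(ltW e0) // /n lerDl //.
- move=> l sl lq; apply/ltnW/max_poly_roots => //; first by apply/allP => x /lq.
  rewrite uniq_pairwise; apply: sub_pairwise sl => x y /=; apply: contraTneq => ->.
  by rewrite subrr normr0 -ltNge mulr_gt0 // powR_gt0.
Qed.

Lemma finite_lower_bound (T : finType) (F : T -> R) : (forall i, 0 < F i) ->
  exists2 c : R, 0 < c & forall i, c <= F i.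
Proof.
move=> F0.
have H : \forall e \near (0 : R)^'+, forall i, e <= F i.
  by apply: filter_forall => i; exact: nbhs_right_le.
have [c [c0 cF]] := filter_ex (filterI (nbhs_right_gt (0 : R)) H).
by exists c.
Qed.

End Null.

(** * Counting exceptional parameters *)

Section Exceptional.
Context {R : realType} {k : nat} (a b : 'rV[R]_k.+1).
Hypotheses (ha : partition_points a) (hab : Z_independent a b).
Local Notation bp := (breakpoint a).
Local Notation f := (pw_map a b).
Local Notation A := ('I_k.+1 * bool)%type.
Implicit Types (lam : R).

Lemma breakpoint_itv (i : 'I_k.+2) : 0 <= bp i <= 1.
Proof.
rewrite -{1}(breakpoint_first ha) -(breakpoint_last a) !breakpoint_le //.
- by rewrite leq0n -ltnS ltn_ord.
- by rewrite -ltnS ltn_ord leqnn.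
Qed.

(** Equality would make some a_i - b_j an integer; the last breakpoint counts as a_0 + 1. *)
Lemma translation_neq_breakpoint (e : A) (i : 'I_k.+2) :
  translation b e != bp i.
Proof.
apply/eqP; rewrite /translation /mod1; case: e => j h /= E.
have [j' [M Ej]] : exists (j' : 'I_k.+1) (M : int), bp i = a ord0 j' + M%:~R.
  have := ltn_ord i; rewrite ltnS leq_eqVlt => /orP[/eqP ->|ik].
    exists ord0, 1; rewrite -breakpoint_ord /= (breakpoint_first ha).
    by rewrite breakpoint_last add0r.
  by exists (Ordinal ik), 0; rewrite -breakpoint_ord addr0.
have := hab j' j; apply/negP; rewrite negbK.
rewrite (_ : _ - _ = (- (Num.floor (b ord0 j) + h%:Z + M))%:~R) ?intr_int //.
rewrite rmorphN !rmorphD /= -[X in _ = - (_ + X + _)]/(h%:R).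
move: E; rewrite Ej; move: (a ord0 j') (b ord0 j) => u w; lra.
Qed.

Lemma exists_translation_gap : exists2 c : R, 0 < c &
  forall (e : A) (i : 'I_k.+2), c <= `|translation b e - bp i|.
Proof.
have [|c c0 H] := @finite_lower_bound R (A * 'I_k.+2)%type
    (fun z => `|translation b z.1 - bp z.2|).
  by move=> [e i]; rewrite normr_gt0 subr_eq0 translation_neq_breakpoint.
by exists c => // e i; exact: (H (e, i)).
Qed.

Lemma separated_breakpoints_or_root p lam :
  (exists n, separated_breakpoints a b p n.+1%:R^-1 lam) \/
  exists (v : seq A) (i j : 'I_k.+2), v != [::] /\
    root (word_poly b (bp i) v - (bp j)%:P) lam.
Proof.
have [|nr] := pselect (exists (v : seq A) (i j : 'I_k.+2), v != [::] /\
    root (word_poly b (bp i) v - (bp j)%:P) lam); [by right|left].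
(* Finitely many words have length at most p, so a positive minimum exists; the empty word, excluded
   from the condition, gets the dummy value 1. *)
pose F (z : p.-bseq A * 'I_k.+2 * 'I_k.+2) : R :=
  if nilp (z.1.1) then 1 else `|affine_word b lam (bp z.1.2) z.1.1 - bp z.2|.
have [|c c0 cF] := @finite_lower_bound R _ F.
  move=> [[v i] j]; rewrite /F /=; case: ifP => // /negbT v0.
  rewrite normr_gt0; apply/negP => /eqP E; apply: nr; exists v, i, j; split.
    by apply: contra v0 => /eqP ->.
  by rewrite rootE !hornerE horner_word_poly E.
have c20 : 0 < c / 2 by rewrite divr_gt0.
have [n _ /(_ n (leqnn n)) nc] := near_infty_natSinv_lt (PosNum c20).
exists n => v i j /andP[v0 vp].
have := cF ((Bseq (ltnW vp)), i, j); rewrite /F /= /nilp eqn0Ngt v0 /=.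
by apply: lt_le_trans; rewrite mulrC -ltr_pdivlMr.
Qed.

(** [d] makes the main term of the small-value bound at most c / 2; [p] then lets rho^(p s) beat the
    factor [#|A|] ^ d by which words multiply when the scale shrinks by rho^p. *)
Variables (s r c : R) (d p : nat).
Hypotheses (s0 : 0 < s) (r01 : 0 < r < 1) (c0 : 0 < c) (d0 : (0 < d)%N).
Hypothesis p0 : (0 < p)%N.
Hypothesis hc : forall (e : A) (i : 'I_k.+2), c <= `|translation b e - bp i|.
Hypothesis hd : r ^+ d * (2 / (1 - r ^+ 2)) <= c / 2.
Hypothesis hp : (#|{: A}| ^ d)%:R * ((r ^+ 2) `^ s) ^+ p < 1.
Local Notation rho := (r ^+ 2).

(** More than d such points would push the constant term of the polynomial below the gap c. *)
Lemma word_poly_small_values (v : seq A) (i : 'I_k.+2) t e l :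
  v != [::] -> 0 < t <= 1 -> 0 <= e -> (4 / t) ^+ d * e < c / 2 -> spaced t l ->
  (forall x, x \in l ->
     0 <= x <= rho /\ `|affine_word b x 0 v - bp i| <= e) ->
  (size l <= d)%N.
Proof.
move=> v0 t01 e0 te sl lv; rewrite leqNgt; apply/negP => dl.
pose q := word_poly b 0 v - (bp i)%:P.
have := coef0_le_small_values_scaled (p := q) (B := 2) (l := take d l) r01 t01 e0.
rewrite size_takel ?(ltnW dl) // => H.
have : c <= `|q`_0|.
  case/lastP: v v0 @q lv H => // v x _ q _ _.
  by rewrite /q coefB coefC /= coef0_word_poly; exact: hc.
apply/negP; rewrite -ltNge; apply: le_lt_trans (H _ _ _) _.
- move=> j; rewrite /q coefB coefC (le_trans (ler_normB _ _)) //.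
  rewrite (_ : 2 = 1 + 1) // lerD //; first by rewrite coef_word_poly_le ?normr0.
  have /andP[b0 b1] := breakpoint_itv i.
  by case: eqP => _; rewrite ?normr0 // ger0_norm.
- by apply: subseq_pairwise sl; exact: take_subseq.
- move=> x /mem_take /lv[x0 xe]; split=> //.
  by rewrite /q !hornerE horner_word_poly.
- by rewrite [ltRHS](splitr c) ler_ltD.
Qed.

(** A t-spaced list in [Q] is sorted by code word and by the breakpoint approached: sparse branching
    bounds the words, small values bound each fibre by d. *)
Lemma hausdorff_null_piece (delta eta : R) (Q : set R) :
  0 < delta -> eta / (1 - rho) <= delta / 2 ->
  (forall lam, Q lam -> [/\ 0 <= lam <= rho, separated_breakpoints a b p delta lam
     & forall n (e : R), 0 < e -> exists x (i : 'I_k.+2),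
         unit_interval x /\ `|iter n (f lam) x - bp i| < e]) ->
  (forall lam lam', Q lam -> Q lam' -> `|lam - lam'| <= eta) ->
  hausdorff_null s Q.
Proof.
move=> delta0 heta HQ Qeta.
have /andP[r0 r1] := r01.
have rho0 : 0 < rho by rewrite exprn_gt0.
have rho1 : rho < 1 by rewrite exprn_ilt1 // ltW.
have rho01 : 0 <= rho < 1 by rewrite ltW.
have d20 : 0 < delta / 2 by rewrite divr_gt0.
have [n1 hn1] := exists_expr_lt 1 rho01 d20.
pose n0 := n1.+1.
have rho_n0 : rho ^+ n0 + eta / (1 - rho) <= delta.
  rewrite (splitr delta) lerD // ltW // -[ltLHS]mulr1; apply: hn1; exact: leqnSn.
(* At least 4, so that (4 / Cst)^d <= 4 / Cst, and above 16 / c, so that 8 / Cst < c / 2. *)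
pose Cst : R := 4 + 16 / c.
have C4 : 4 <= Cst by rewrite lerDl divr_ge0 // ltW.
have C0 : 0 < Cst by apply: lt_le_trans C4.
have Cc : 8 / Cst < c / 2.
  rewrite ltr_pdivrMr // (_ : c / 2 * Cst = 2 * c + 8) ?ltrDr ?mulr_gt0 //.
  by rewrite /Cst; field; rewrite gt_eqF.
pose K : R := (#|{: A}| ^ n0.+1 * (k.+2 * d))%:R * (2 * Cst) `^ s.
pose theta : R := (#|{: A}| ^ d)%:R * (rho `^ s) ^+ p.
have theta01 : 0 <= theta < 1.
  by rewrite hp mulr_ge0 // exprn_ge0 // powR_ge0.
apply: spaced_hausdorff_null => // e e0.
have [L1 HL1] := exists_expr_lt K theta01 e0.
have [L2 HL2] := exists_expr_lt Cst rho01 ltr01.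
pose l := maxn L1 L2.
pose t := Cst * rho ^+ (p * l).
have t0 : 0 < t by rewrite mulr_gt0 // exprn_gt0.
have t1 : t <= 1.
  rewrite ltW // /t mulrC; apply: HL2.
  by rewrite (leq_trans (leq_maxr L1 L2)) // leq_pmull.
(* Long enough that rho^N offsets the factor t^(-d) in the small-value bound. *)
pose N := (n0 + (d * l) * p)%N.
exists t, (#|{: A}| ^ (n0.+1 + d * l) * (k.+2 * d))%N; split; first exact: ltW.
  have -> : (2 * t) `^ s = (2 * Cst) `^ s * (rho `^ s) ^+ (p * l).
    rewrite /t mulrA powRM ?exprn_ge0 ?mulr_ge0 ?(ltW C0) ?(ltW r0) //.
    by rewrite -(powR_mulrn (p * l) (ltW rho0)) -(powR_mulrn (p * l) (powR_ge0 rho s)) powRAC.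
  have -> : (#|{: A}| ^ (n0.+1 + d * l) * (k.+2 * d))%:R *
      ((2 * Cst) `^ s * (rho `^ s) ^+ (p * l)) = theta ^+ l * K.
    by rewrite /theta /K exprMn -exprM expnD expnM !natrM !natrX; ring.
  by apply/ltW/HL1; exact: leq_maxl.
move=> L sL QL.
have rhoN : 0 < rho ^+ N by rewrite exprn_gt0.
have /choice[g Hg] : forall lam, exists z : R * 'I_k.+2, Q lam ->
    unit_interval z.1 /\ `|iter N (f lam) z.1 - bp z.2| < rho ^+ N.
  move=> lam; have [/HQ[_ _ /(_ N _ rhoN)[x [i H]]]|nQ] := pselect (Q lam).
    by exists (x, i).
  by exists (0, ord0).
have l01 lam : Q lam -> 0 <= lam <= 1.
  by move=> /HQ[/andP[-> h] _ _]; rewrite (le_trans h) // ltW.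
(* One letter more than N: the carry of step N - 1 is recorded at time N. *)
pose W lam := mkseq (orbit_code a b lam (g lam).1) N.+1.
apply: leq_trans (size_le_fibers (h := W) (K := k.+2 * d) _) _; last first.
  rewrite leq_mul2r; apply/orP; right.
  pose om := { z : R * R | Q z.1 /\ unit_interval z.2 }.
  pose co (w : om) := orbit_code a b (sval w).1 (sval w).2.
  apply: (@size_prefixes_le A om co (fun=> True) n0.+1 p).
  - move=> [[lam1 x1] /= [Q1 I1]] [[lam2 x2] /= [Q2 I2]] [[lam3 x3] /= [Q3 I3]].
    move=> j m _ _ _; rewrite /co /=.
    have [h1 sep1 _] := HQ _ Q1; have [h2 _ _] := HQ _ Q2; have [h3 _ _] := HQ _ Q3.
    exact: (code_sparse ha h1 h2 h3 rho1 I1 I2 I3 (Qeta _ _ Q1 Q2) (Qeta _ _ Q1 Q3) rho_n0 sep1).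
  - exact: undup_uniq.
  - move=> u; rewrite mem_undup => /mapP[lam /QL Qlam ->].
    by exists (exist _ (lam, (g lam).1) (conj Qlam (Hg _ Qlam).1)).
move=> w; rewrite -size_filter; set L' := [seq lam <- L | W lam == w].
have QL' lam : lam \in L' -> Q lam /\ W lam = w.
  by rewrite mem_filter => /andP[/eqP <- /QL].
apply: leq_trans (size_le_fibers (h := fun lam => (g lam).2) (K := d) _) _; last first.
  rewrite leq_mul2r -[k.+2 in leqRHS]card_ord cardE; apply/orP; right.
  by apply: uniq_leq_size (undup_uniq _) _ => j _; rewrite mem_enum.
move=> i; rewrite -size_filter; set L'' := [seq lam <- L' | (g lam).2 == i].
have QL'' lam : lam \in L'' -> [/\ Q lam, W lam = w & (g lam).2 = i].
  by rewrite mem_filter => /andP[/eqP <- /QL'[]].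
have [->|[lam0 lam0L]] : L'' = [::] \/ exists lam0, lam0 \in L''.
- by case: L'' {QL''} => [|x L'']; [left|right; exists x; rewrite mem_head].
- by [].
have [Q0 W0 _] := QL'' _ lam0L.
pose v := step_word a b lam0 (g lam0).1 N.
(* One rho^N is the distance to the breakpoint, the other the cost of moving the starting point to
   0, which leaves one polynomial for the whole fibre. *)
apply: (@word_poly_small_values v i t (2 * rho ^+ N)).
- by rewrite -size_eq0 size_mkseq.
- by rewrite t0.
- by rewrite mulr_ge0 // ltW.
- apply: le_lt_trans Cc.
  have h1 : rho ^+ N <= (rho ^+ (p * l)) ^+ d.
    rewrite -[leRHS]exprM ler_wiXn2l ?(ltW rho0) ?(ltW rho1) //.
    by rewrite mulnC [(p * l)%N]mulnC mulnA leq_addl.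
  have h2 : (4 / Cst) ^+ d <= 4 / Cst.
    rewrite -[leRHS]expr1 ler_wiXn2l // ?divr_ge0 ?(ltW C0) //.
    by rewrite ler_pdivrMr // mul1r.
  have h3 : (4 / t) ^+ d * (rho ^+ (p * l)) ^+ d = (4 / Cst) ^+ d.
    rewrite -exprMn; congr (_ ^+ d); rewrite /t invfM mulrA divfK //.
    by rewrite gt_eqF // exprn_gt0.
  have h4 : (4 / t) ^+ d * rho ^+ N <= 4 / Cst.
    by apply: le_trans h2; rewrite -h3 ler_wpM2l // exprn_ge0 // divr_ge0 // ltW.
  rewrite mulrCA; apply: (le_trans (ler_wpM2l _ h4)) => //; lra.
- by apply: subseq_pairwise sL; rewrite (subseq_trans (filter_subseq _ _)) ?filter_subseq.
move=> lam lamL; have [Ql Wl gi] := QL'' _ lamL; split; first by have [] := HQ _ Ql.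
have [xI xi] := Hg _ Ql.
have vE : v = step_word a b lam (g lam).1 N.
  by apply: step_word_code; apply/mkseq_eqP; rewrite -/(W _) -/(W _) W0 Wl.
rewrite (le_trans (ler_distD (iter N (f lam) (g lam).1) _ _)) // mulrDl mul1r.
rewrite -gi lerD //; last exact: ltW.
rewrite iter_affine_word ?l01 // -vE affine_word_dist; last by have /andP[] := l01 _ Ql.
have /andP[lam0' lamr] : 0 <= lam <= rho by have [] := HQ _ Ql.
have /unit_intervalE/andP[x0 x1] := xI.
rewrite size_mkseq sub0r normrN ger0_norm // -[leRHS]mulr1.
by rewrite ler_pM ?exprn_ge0 ?(ltW x1) // lerXn2r ?nnegrE // ltW.
Qed.

End Exceptional.

(** Countable unions preserve nullity, so the bound rho, the separation delta and a cell of length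
    eta may be fixed one after another. *)
Lemma exceptional_set_hausdorff_null (R : realType) (k : nat) (a b : 'rV[R]_k.+1)
    (s : R) : partition_points a -> Z_independent a b -> 0 < s ->
  hausdorff_null s (exceptional_set a b).
Proof.
move=> ha hab s0.
have [c c0 hc] := exists_translation_gap ha hab.
pose r (q : nat) : R := 1 - q.+2%:R^-1.
have r01 q : 0 < r q < 1.
  by rewrite subr_gt0 invf_lt1 ?ltr0n // ltr1n /= ltrBlDr ltrDl invr_gt0 ltr0n.
apply: (@hausdorff_null_bigcup _ _ nat
  (fun q => exceptional_set a b `&` [set lam | lam <= r q ^+ 2])) => //.
  move=> lam Elam; have [/andP[_ l1] _] := Elam.
  (* If x < (1 - lam) / 2 then (1 - x)^2 >= 1 - 2 x > lam. *)
  have l20 : 0 < (1 - lam) / 2 by rewrite divr_gt0 // subr_gt0.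
  have [q _ /(_ q.+1 (leqnSn _)) ql] := near_infty_natSinv_lt (PosNum l20).
  exists q; split=> //=; rewrite /r; move: ql; rewrite /=; set x := _^-1.
  by rewrite ltr_pdivlMr // => ql; have := sqr_ge0 x; nra.
move=> q; have /andP[r0 r1] := r01 q.
set rho := r q ^+ 2.
have rho0 : 0 < rho by rewrite exprn_gt0.
have rho1 : rho < 1 by rewrite exprn_ilt1 // ltW.
have c20 : 0 < c / 2 by rewrite divr_gt0.
have r01' : 0 <= r q < 1 by rewrite ltW.
have [d0 /(_ d0.+1 (leqnSn _))/ltW hd] := exists_expr_lt (2 / (1 - rho)) r01' c20.
have rhos : 0 <= rho `^ s < 1.
  by rewrite powR_ge0 -[ltRHS](congr1 (@^~ s) (powR1 R)) gt0_ltr_powR ?nnegrE ?ltW.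
pose A := ('I_k.+1 * bool)%type.
have [p0 /(_ p0.+1 (leqnSn _)) hp] :=
  exists_expr_lt ((#|{: A}| ^ d0.+1)%:R : R) rhos ltr01.
pose p := p0.+1.
pose delta (n : nat) : R := n.+1%:R^-1.
pose eta n := delta n / 2 * (1 - rho).
have delta0 n : 0 < delta n by rewrite invr_gt0 ltr0n.
have eta0 n : 0 < eta n by rewrite mulr_gt0 ?subr_gt0 // divr_gt0.
pose F (z : (seq A * 'I_k.+2 * 'I_k.+2) + nat * nat) : set R :=
  match z with
  | inl (v, i, j) => [set lam | v != [::] /\
      root (word_poly b (breakpoint a i) v - (breakpoint a j)%:P) lam]
  | inr (n, j) => [set lam | [/\ exceptional_set a b lam, lam <= rho,
      separated_breakpoints a b p (delta n) lam & Num.truncn (lam / eta n) = j]]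
  end.
apply: (@hausdorff_null_bigcup _ _ _ F) => //.
  move=> lam [Elam lamr].
  have [[n sep]|[v [i [j vij]]]] := separated_breakpoints_or_root a b p lam.
    by exists (inr (n, Num.truncn (lam / eta n))).
  by exists (inl (v, i, j)).
move=> [[[v i] j]|[n j]].
  (* The piece of the empty word is empty; the root set of X serves as a null superset. *)
  have [->|v0] := eqVneq v [::].
    apply: (@sub_hausdorff_null _ _ _ [set x | root ('X : {poly R}) x]).
      by move=> x [].
    by apply: root_hausdorff_null => //; rewrite polyX_eq0.
  apply: (@sub_hausdorff_null _ _ _
      [set x | root (word_poly b (breakpoint a i) v - (breakpoint a j)%:P) x]).
    by move=> x [].
  apply: root_hausdorff_null => //; apply/eqP => /(congr1 (fun u : {poly R} => u`_0)).
  case/lastP: v v0 => // v e _; rewrite coefB coefC coef0_word_poly coef0 /=.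
  by move/eqP; rewrite subr_eq0 (negbTE (translation_neq_breakpoint ha hab e j)).
apply: (@hausdorff_null_piece _ _ a b ha s (r q) c d0.+1 p _ _ _ _ _ _ _ _ (delta n) (eta n)) => //.
- by rewrite mulrC.
- by rewrite /eta mulfK // subr_eq0 gt_eqF.
- move=> lam [Elam lamr sep _]; split=> //.
    by have [/andP[/ltW-> _] _] := Elam.
  move=> m e e0; exact: exceptional_near_breakpoint.
- move=> lam lam' [[/andP[l0 _] _] _ _ E] [[/andP[l0' _] _] _ _ E'].
  have h0 : 0 <= lam / eta n by rewrite divr_ge0 // ltW.
  have h0' : 0 <= lam' / eta n by rewrite divr_ge0 // ltW.
  have /andP[] := truncn_itv h0; have /andP[] := truncn_itv h0'.
  rewrite E E' -natr1 !ler_pdivlMr // !ltr_pdivrMr //.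
  by set J := j%:R; rewrite ler_norml => *; apply/andP; split; lra.
Qed.

Theorem theorem5 (R : realType) (k : nat) (hk : (0 < k)%N) (a b : 'rV[R]_k)
    (ha : partition_points a) (hab : Z_independent a b) :
  hausdorff_dim (exceptional_set a b) = 0%E.
Proof.
case: k hk a b ha hab => // k _ a b ha hab.
by apply: hausdorff_null_dim => s; exact: exceptional_set_hausdorff_null.
Qed.
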